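(* Let $g$ be a Honda metric on $3\mathbb{CP}_2$. There is an efficient linearization $\alpha$, i.e. one whose efficiency dimension $\mathrm{Ed}(\alpha)$ is minimal among all linearizations, such that the image of the minitwistor space of $g$ computed according to $\alpha$, namely the categorical quotient $\mathbb C^4/\!\!/_{\alpha}T$, is isomorphic to the complex weighted projective space $\mathbb{CP}_{1,1,2}$.
   Context: Honda metrics. A Honda metric is a self-dual metric $g$ on $3\mathbb{CP}_2$ (connected sum of three copies of $\mathbb{CP}_2$) which admits a non-trivial Killing field, is of positive scalar curvature type, and is not conformally equivalent to one of LeBrun's hyperbolic ansatz self-dual metrics. By a theorem of Honda, its twistor space $\mathcal Z$ is a small resolution of the double cover of $\mathbb{CP}_3$ branched along a quartic $$(Z_2Z_3+Q(Z_0,Z_1))^2-Z_0Z_1(Z_0+Z_1)(Z_0-aZ_1)=0,$$ with $Q$ a real quadratic form and $a>0$, and the naturally induced $U(1)$-action on $\mathbb{CP}_3$ is $(Z_0:Z_1:Z_2:Z_3)\mapsto(Z_0:Z_1:e^{i\theta}Z_2:e^{-i\theta}Z_3)$. Minitwistor space and its image. The circle action extends to a holomorphic $\mathbb C^*$-action on $\mathcal Z$, and the minitwistor space is the quotient $\mathcal Z/\mathbb C^*$. Its image (under the double branched cover) is the quotient of $\mathbb{CP}_3$ by the $\mathbb C^*$-action $(Z_0:Z_1:Z_2:Z_3)\mapsto(Z_0:Z_1:\lambda Z_2:\lambda^{-1}Z_3)$, $\lambda\in\mathbb C^*$. Combining this with the scaling action that defines $\mathbb{CP}_3$, the image is the quotient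 of $\mathbb C^4$ by $T=(\mathbb C^* )^2$ acting through the matrix $$A=\begin{bmatrix}1&1&1&1\\0&0&1&-1\end{bmatrix},\qquad (t_1,t_2)\cdot(X,Y,Z,W)=(t_1X,\;t_1Y,\;t_1t_2Z,\;t_1t_2^{-1}W).$$ This quotient is taken in the sense of Geometric Invariant Theory and depends on the choice of a linearization. Linearizations and quotients. For $\alpha=(\alpha_1,\alpha_2)\in\mathbb Z^2$, the linearization $L_\alpha$ is the trivial line bundle on $\mathbb C^4$ with $T$-action $t\cdot(v,w)=(t\cdot v,\;t_1^{\alpha_1}t_2^{\alpha_2}w)$. The $T$-invariant sections of $L_\alpha^{\otimes d}$ are the polynomials $G$ on $\mathbb C^4$ with $G(t\cdot v)=(t_1^{\alpha_1}t_2^{\alpha_2})^{d}G(v)$ for all $t\in T$. A point is semi-stable with respect to $L_\alpha$ if it lies in $\mathbb C^4\setminus\{s=0\}$ for some $d>0$ and some $T$-invariant section $s$ of $L_\alpha^{\otimes d}$; otherwise it is unstable. $\mathbb C^4/\!\!/_\alpha T$ denotes the categorical quotient of the semi-stable locus $(\mathbb C^4)^{ss}(L_\alpha)$ by $T$. A categorical quotient of a $T$-variety $V$ is a $T$-invariant morphism $p:V\to Q$ such that every $T$-invariant morphism $V\to Q'$ factors uniquely through $p$. Efficiency. The efficiency dimension $\mathrm{Ed}(\alpha)$ is the maximum dimension of the part of $\mathbb C^4$ omitted by the quotient, i.e. of the locus of unstable points in $\mathbb C^4$. A linearization with smaller efficiency dimension is called more efficient. The weighted projective space $\mathbb{CP}_{1,1,2}$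 is the quotient of $\mathbb C^3\setminus\{0\}$ by the $\mathbb C^*$-action $\lambda\cdot(x,y,z)=(\lambda x,\lambda y,\lambda^2z)$.
   Formalization: The trivial linearization (0,0), which has no unstable points and a one-point quotient, is excluded from the minimality comparison (else the claim fails); the metric enters only through its branch quartic, on which the quotient does not depend. *)

(* Defs.v *)
(* Zariski topologies are handled explicitly, since the canonical topology on
   'rV[R[i]]_n is the metric one. *)
From mathcomp Require Import all_boot all_order all_algebra.
From mathcomp Require Import boolp classical_sets reals.
From mathcomp Require Import complex mpoly.

Set Implicit Arguments.
Unset Strict Implicit.
Unset Printing Implicit Defensive.

Import Order.TTheory GRing.Theory Num.Theory.

Local Open Scope classical_set_scope.
Local Open Scope ring_scope.

(** * Varieties as spaces with functions

   Classical varieties are encoded, following Kempf's "Algebraic Varieties", as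
   topological spaces with a sheaf of K-valued functions.  [fspace] is the raw
   data and [space_with_functions] gives the axioms.  A function on an open set U
   is represented by a total function of which only the values on U matter. *)

Record fspace (K : closedFieldType) : Type := FSpace {
  carrier :> Type;
  zopen : set (set carrier);
  regular : set carrier -> set (carrier -> K) }.

Section Spaces.
Variable K : closedFieldType.
Implicit Types X Y V Q : fspace K.

Definition zclosed X (F : set X) : Prop := zopen (~` F).

Record space_with_functions X : Prop := SpaceWithFunctions {
  zopenT : zopen [set: X];
  zopenI : forall U V : set X, zopen U -> zopen V -> zopen (U `&` V);
  zopen_bigcup : forall F : set (set X),
    F `<=` @zopen K X -> zopen (\bigcup_(U in F) U);
  regular_ext : forall (U : set X) (f g : X -> K), zopen U ->
    (forall x, U x -> f x = g x) -> regular U f -> regular U g;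
  regular_sheaf : forall (F : set (set X)) (f : X -> K),
    F `<=` @zopen K X ->
    (regular (\bigcup_(U in F) U) f <-> forall U, F U -> regular U f);
  regular_cst : forall (U : set X) (c : K), zopen U -> regular U (fun=> c);
  regularD : forall (U : set X) (f g : X -> K), zopen U ->
    regular U f -> regular U g -> regular U (fun x => f x + g x);
  regularM : forall (U : set X) (f g : X -> K), zopen U ->
    regular U f -> regular U g -> regular U (fun x => f x * g x);
  zopen_nonvanishing : forall (U : set X) (f : X -> K), zopen U ->
    regular U f -> zopen (U `&` [set x | f x != 0]);
  regularV : forall (U : set X) (f : X -> K), zopen U ->
    regular U f -> regular (U `&` [set x | f x != 0]) (fun x => (f x)^-1) }.

Definition regular_map X Y (f : X -> Y) : Prop :=
  (forall U : set Y, zopen U -> zopen (f @^-1` U)) /\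
  (forall (U : set Y) (h : Y -> K), zopen U -> regular U h ->
     regular (f @^-1` U) (h \o f)).

Definition isomorphic X Y : Prop :=
  exists f : X -> Y, exists g : Y -> X,
    [/\ regular_map f, regular_map g, cancel f g & cancel g f].

(* Functions on a subspace are regular when they are locally restrictions of
   regular functions of the ambient space. *)
Definition fsubspace X (A : set X) : fspace K :=
  @FSpace K (set_type A)
    [set W | exists2 U : set X, zopen U & W = [set x | U (val x)]]
    (fun W => [set f : set_type A -> K | forall x, W x ->
       exists U : set X, exists h : X -> K,
         [/\ zopen U, U (val x), regular U h &
             forall y, W y -> U (val y) -> f y = h (val y)]]).

Definition affine_space (n : nat) : fspace K :=
  @FSpace K 'rV[K]_n
    [set U | exists S : set {mpoly K[n]},
       U = [set v : 'rV[K]_n | exists2 p, S p & p.@[v 0] != 0]]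
    (fun U => [set f : 'rV[K]_n -> K | forall v : 'rV[K]_n, U v ->
       exists p q : {mpoly K[n]}, q.@[v 0] != 0 /\
         forall w : 'rV[K]_n, U w -> q.@[w 0] != 0 -> f w = p.@[w 0] / q.@[w 0]]).

Definition affine_variety X : Prop :=
  exists (n : nat) (Z : set (affine_space n)),
    zclosed Z /\ isomorphic X (fsubspace Z).

Definition prevariety X : Prop :=
  space_with_functions X /\
  exists (n : nat) (U : 'I_n -> set X),
    [/\ forall i, zopen (U i), forall x, exists i, U i x &
        forall i, affine_variety (fsubspace (U i))].

(* Separatedness is expressed by closedness of equalizers, which is closedness
   of the diagonal without the construction of products.  Varieties are not
   assumed to be irreducible. *)
Definition separated X : Prop :=
  forall (Y : fspace K) (f g : Y -> X), prevariety Y -> regular_map f ->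
    regular_map g -> zclosed [set y | f y = g y].

Definition variety X : Prop := prevariety X /\ separated X.

(** * Dimension *)

Definition irreducible X (Z : set X) : Prop :=
  Z !=set0 /\
  forall F G : set X, zclosed F -> zclosed G -> Z `<=` F `|` G ->
    Z `<=` F \/ Z `<=` G.

Definition irreducible_chain X (n : nat) (Z : nat -> set X) : Prop :=
  (forall i, (i <= n)%N -> zclosed (Z i) /\ irreducible (Z i)) /\
  (forall i, (i < n)%N -> Z i `<` Z i.+1).

(* [has_dimension X n]: n is the maximal length of a chain of irreducible closed
   subsets of X.  The empty space has no dimension. *)
Definition has_dimension X (n : nat) : Prop :=
  (exists Z, irreducible_chain (X := X) n Z) /\
  (forall m Z, irreducible_chain (X := X) m Z -> (m <= n)%N).

(** * Quotients *)

(* Set of orbits with the quotient topology and the functions that are regular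
   upstairs; [e x y] is meant to say that x and y lie in the same orbit. *)
Definition orbits X (e : X -> X -> Prop) : Type :=
  {O : set X | exists x, O = e x}.

Definition orbit_of X (e : X -> X -> Prop) (x : X) : orbits e :=
  exist _ (e x : set X) (ex_intro _ x erefl).

Definition quotient_space X (e : X -> X -> Prop) : fspace K :=
  @FSpace K (orbits e)
    [set W | zopen (orbit_of e @^-1` W)]
    (fun W => [set f : orbits e -> K |
                regular (orbit_of e @^-1` W) (f \o orbit_of e)]).

Definition categorical_quotient V (e : V -> V -> Prop) Q (p : V -> Q) : Prop :=
  let invariant Y (f : V -> Y) := forall x y, e x y -> f x = f y in
  [/\ variety Q, regular_map p, invariant Q p &
      forall (Y : fspace K) (f : V -> Y), variety Y -> regular_map f ->
        invariant Y f ->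
        exists! h : Q -> Y, regular_map h /\ forall x, h (p x) = f x].

(* Quotient of K^n minus the origin by the action of the multiplicative group
   with weights w. *)
Definition weighted_projective_space n (w : 'I_n -> nat) : fspace K :=
  quotient_space
    (X := fsubspace [set v : affine_space n | (v : 'rV[K]_n) != 0])
    (fun x y => exists2 l : K, l != 0 &
       (val y : 'rV[K]_n) = \row_j (l ^+ w j * (val x : 'rV[K]_n) 0 j)).

Definition CP112 : fspace K :=
  weighted_projective_space (fun i : 'I_3 => nth 0%N [:: 1; 1; 2]%N i).

(** * The torus action on C^4 and its linearizations *)

Definition weight_matrix : 'M[int]_(2, 4) :=
  \matrix_(i < 2, j < 4) nth 0 (nth [::] [:: [:: 1; 1; 1;  1];
                                            [:: 0; 0; 1; -1]] i) j.

Definition torus : set (K * K) := [set t | t.1 != 0 /\ t.2 != 0].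

Definition torus_act (t : K * K) (v : 'rV[K]_4) : 'rV[K]_4 :=
  \row_j (t.1 ^ weight_matrix 0 j * t.2 ^ weight_matrix 1 j * v 0 j).

Definition linearization : Type := (int * int)%type.
Implicit Types a b : linearization.

Definition invariant_section a (d : nat) (G : {mpoly K[4]}) : Prop :=
  forall (t : K * K) (v : 'rV[K]_4), torus t ->
    G.@[torus_act t v 0] = (t.1 ^ a.1 * t.2 ^ a.2) ^+ d * G.@[v 0].

Definition semistable a : set (affine_space 4) :=
  [set v | exists (d : nat) (G : {mpoly K[4]}),
     [/\ (0 < d)%N, invariant_section a d G & G.@[(v : 'rV[K]_4) 0] != 0]].

Definition unstable a : set (affine_space 4) := ~` semistable a.

Definition Ed a (n : nat) : Prop := has_dimension (fsubspace (unstable a)) n.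

(* Pitfall: for the trivial linearization a = (0, 0) the nonzero constants are
   invariant sections, so that no point is unstable and the quotient is a single
   point.  As the empty set has no dimension, Ed (0, 0) is undefined and the
   trivial linearization does not take part in the comparison. It is the only
   linearization without unstable points: the origin is unstable for all others. *)
Definition efficient a : Prop :=
  exists2 n, Ed a n & forall b m, Ed b m -> (n <= m)%N.

Definition same_orbit a (x y : fsubspace (semistable a)) : Prop :=
  exists2 t : K * K, torus t & (val y : 'rV[K]_4) = torus_act t (val x).

(* [git_quotient a p]: the map p exhibits its target as C^4 //_a T. *)
Definition git_quotient a Q (p : fsubspace (semistable a) -> Q) : Prop :=
  categorical_quotient (same_orbit (a := a)) p.

End Spaces.

Arguments semistable K a : clear implicits.
Arguments unstable K a : clear implicits.
Arguments Ed K a n : clear implicits.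
Arguments efficient K a : clear implicits.

(** * Honda metrics

   By Honda's theorem the twistor space of a Honda metric is a small resolution
   of the double cover of CP_3 branched along a quartic of the following form;
   this quartic stands for the metric.  The real quadratic form is
   Q(Z0, Z1) = q0 Z0^2 + q1 Z0 Z1 + q2 Z1^2. *)
Definition honda_quartic (R : realType) (B : {mpoly R[i][4]}) : Prop :=
  exists (q0 q1 q2 a : R),
    0 < a /\
    let c (r : R) : {mpoly R[i][4]} := (r%:C)%C%:MP in
    let Z (k : nat) : {mpoly R[i][4]} := 'X_(inord k) in
    let Q := c q0 * Z 0%N ^+ 2 + c q1 * (Z 0%N * Z 1%N) + c q2 * Z 1%N ^+ 2 in
    B = (Z 2%N * Z 3%N + Q) ^+ 2
        - Z 0%N * Z 1%N * (Z 0%N + Z 1%N) * (Z 0%N - c a * Z 1%N).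

(* Main.v *)
(* Take alpha = (1, 0).  Its unstable locus is the union of the Z-axis and the
   W-axis, of dimension 1.  For any other nonzero linearization one of these two
   axes is unstable as well, because its stabilizer acts on the fibre by a
   nontrivial character; so alpha is efficient.

   The quotient map is (X, Y, Z, W) |-> [X : Y : ZW].  The slice W = 1 is a
   global section of (X, Y, ZW) lying in the semistable locus, so a T-invariant
   morphism f descends to CP112 as soon as it is constant on the fibres.  The
   only fibres that are not single orbits are those with ZW = 0; there f takes
   the value at (X, Y, 0, 0), which lies in the closure of the orbit, because
   points of the target are closed.

   That CP112 is a variety is checked with the quadric cone embedding
   (x^2 : xy : y^2 : z).  Its charts x != 0 and y != 0 are planes; the chart
   z != 0 is the affine cone ac = b^2, the quotient of the plane by -1, and there
   invariant fractions become polynomial fractions in a, b, c by taking even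
   parts. *)
Require Import Defs.
From mathcomp Require Import all_boot all_order all_algebra.
From mathcomp Require Import boolp classical_sets reals.
From mathcomp Require Import complex mpoly.
From mathcomp Require Import ring.

Set Implicit Arguments.
Unset Strict Implicit.
Unset Printing Implicit Defensive.

Import Order.TTheory GRing.Theory Num.Theory.

Local Open Scope classical_set_scope.
Local Open Scope ring_scope.

Local Notation o2 k := (@Ordinal 2 k isT).
Local Notation o3 k := (@Ordinal 3 k isT).
Local Notation o4 k := (@Ordinal 4 k isT).

(** * Spaces with functions *)

Section SpacesWithFunctions.
Variable K : closedFieldType.
Implicit Types X Y Z : fspace K.

(** * Local nature of openness and regularity; polynomials in regular functions *)

Section Gluing.
Variable X : fspace K.
Hypothesis swfX : space_with_functions X.
Implicit Types (U V : set X) (f g : X -> K).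

Lemma zopen_local U :
  (forall x, U x -> exists V, [/\ zopen V, V x & V `<=` U]) -> zopen U.
Proof.
move=> locU.
have -> : U = \bigcup_(V in [set V | zopen V /\ V `<=` U]) V.
  apply/seteqP; split=> [x /locU[V [oV Vx sVU]]|x [V [_ sVU] /sVU //]].
  by exists V.
by apply: (zopen_bigcup swfX) => V [].
Qed.

Lemma zopen0 : zopen (set0 : set X).
Proof. exact: zopen_local. Qed.

(** Restriction comes out of the sheaf axiom, applied to the cover of [U] by [U] itself and [V]. *)
Lemma regularS U V f : zopen U -> zopen V -> V `<=` U ->
  regular U f -> regular V f.
Proof.
move=> oU oV sVU rf.
have sF : [set U; V] `<=` @zopen K X by move=> W [] ->.
have eF : \bigcup_(W in [set U; V]) W = U.
  apply/seteqP; split=> [x [W [->|->] //]|x Ux]; first exact: sVU.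
  by exists U => //; left.
by have [+ _] := regular_sheaf swfX f sF; rewrite eF => /(_ rf V); apply; right.
Qed.

Lemma regular_local U f : zopen U ->
  (forall x, U x -> exists V, [/\ zopen V, V x, V `<=` U & regular V f]) ->
  regular U f.
Proof.
move=> oU locU; pose F := [set V | [/\ zopen V, V `<=` U & regular V f]].
have -> : U = \bigcup_(V in F) V.
  apply/seteqP; split=> [x /locU[V [oV Vx sVU rV]]|x [V [_ sVU _] /sVU //]].
  by exists V.
have sF : F `<=` @zopen K X by move=> V [].
by have [_] := regular_sheaf swfX f sF; apply=> V [].
Qed.

Lemma regular_sum (I : Type) (r : seq I) (F : I -> X -> K) U : zopen U ->
  (forall i, regular U (F i)) -> regular U (fun x => \sum_(i <- r) F i x).
Proof.
move=> oU rF; elim: r => [|i r IHr].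
  apply: (regular_ext swfX) (regular_cst swfX 0 oU) => // x _.
  by rewrite big_nil.
apply: (regular_ext swfX) (regularD swfX oU (rF i) IHr) => // x _.
by rewrite big_cons.
Qed.

Lemma regular_prod (I : Type) (r : seq I) (F : I -> X -> K) U : zopen U ->
  (forall i, regular U (F i)) -> regular U (fun x => \prod_(i <- r) F i x).
Proof.
move=> oU rF; elim: r => [|i r IHr].
  apply: (regular_ext swfX) (regular_cst swfX 1 oU) => // x _.
  by rewrite big_nil.
apply: (regular_ext swfX) (regularM swfX oU (rF i) IHr) => // x _.
by rewrite big_cons.
Qed.

Lemma regularX U f k : zopen U -> regular U f -> regular U (fun x => f x ^+ k).
Proof.
move=> oU rf; elim: k => [|k IHk]; first exact: (regular_cst swfX).
apply: (regular_ext swfX) (regularM swfX oU rf IHk) => // x _.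
by rewrite exprS.
Qed.

Lemma regular_meval n (p : {mpoly K[n]}) (c : 'I_n -> X -> K) U : zopen U ->
  (forall i, regular U (c i)) -> regular U (fun x => p.@[fun i => c i x]).
Proof.
move=> oU rc.
apply: (regular_ext swfX (f := fun x => \sum_(m <- msupp p)
  (p@_m * \prod_(i <- index_enum 'I_n) c i x ^+ m i))) => //.
apply: regular_sum => // m; apply: (regularM swfX oU).
  exact: (regular_cst swfX).
by apply: regular_prod => // i; apply: regularX.
Qed.

Lemma regular_div U f g : zopen U -> regular U f -> regular U g ->
  regular (U `&` [set x | g x != 0]) (fun x => f x / g x).
Proof.
move=> oU rf rg; have oV := zopen_nonvanishing swfX oU rg.
apply: (regularM swfX) => //; last exact: (regularV swfX).
by apply: regularS rf => // x [].
Qed.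

End Gluing.

(** * The axioms for subspaces, affine spaces and orbit spaces *)

Lemma swf_fsubspace X (A : set X) :
  space_with_functions X -> space_with_functions (fsubspace A).
Proof.
move=> swfX; split=> /=.
- by exists setT; [exact: (zopenT swfX) | apply/seteqP; split].
- move=> _ _ [U oU ->] [V oV ->].
  by exists (U `&` V); [exact: (zopenI swfX) | apply/seteqP; split].
- move=> F oF.
  (* All ambient open sets with trace in [F] are united, so that no extension has to be chosen for
     each member. *)
  exists (\bigcup_(U in [set U | zopen U /\ F [set x | U (val x)]]) U).
    by apply: (zopen_bigcup swfX) => U [].
  apply/seteqP; split=> [x [W FW Wx]|x [U [_ FU] Ux]].
    by have [U oU eW] := oF _ FW; exists U; rewrite ?eW in FW Wx *.
  by exists [set x | U (val x)].
- move=> W f g _ efg rf x Wx; have [U [h [oU Ux rh eh]]] := rf x Wx.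
  by exists U, h; split=> // y Wy Uy; rewrite -efg ?eh.
- move=> F f oF; split=> [rf W FW x Wx|rf x [W FW Wx]].
    have [|U [h [oU Ux rh eh]]] := rf x; first by exists W.
    by exists U, h; split=> // y Wy Uy; apply: eh => //; exists W.
  have [U [h [oU Ux rh eh]]] := rf W FW x Wx.
  have [V oV eW] := oF _ FW.
  exists (U `&` V), h; have oUV := zopenI swfX oU oV; split=> //.
  + by split=> //; rewrite eW in Wx.
  + by apply: regularS rh => // y [].
  + by move=> y _ [Uy Vy]; apply: eh => //; rewrite eW.
- move=> W c oW x Wx; exists setT, (fun=> c); split=> //.
    exact: (zopenT swfX).
  by apply: (regular_cst swfX); exact: (zopenT swfX).
- move=> W f g oW rf rg x Wx.
  have [U [h [oU Ux rh eh]]] := rf x Wx.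
  have [V [k [oV Vx rk ek]]] := rg x Wx.
  have oUV := zopenI swfX oU oV.
  exists (U `&` V), (fun y => h y + k y); split=> //.
    apply: (regularD swfX) => //;
      by [apply: regularS rh => // y [] | apply: regularS rk => // y []].
  by move=> y Wy [Uy Vy]; rewrite eh ?ek.
- move=> W f g oW rf rg x Wx.
  have [U [h [oU Ux rh eh]]] := rf x Wx.
  have [V [k [oV Vx rk ek]]] := rg x Wx.
  have oUV := zopenI swfX oU oV.
  exists (U `&` V), (fun y => h y * k y); split=> //.
    apply: (regularM swfX) => //;
      by [apply: regularS rh => // y [] | apply: regularS rk => // y []].
  by move=> y Wy [Uy Vy]; rewrite eh ?ek.
- move=> W f [V oV eW] rf.
  pose P (U : set X) := zopen U /\
    [set x | U (val x)] `<=` W `&` [set x : set_type A | f x != 0].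
  exists (\bigcup_(U in P) U); first by apply: (zopen_bigcup swfX) => U [].
  apply/seteqP; split=> [x [Wx fx]|x [U [_ sU] /sU //]].
  have [U [h [oU Ux rh eh]]] := rf x Wx.
  have oUV := zopenI swfX oU oV.
  have rhUV : regular (U `&` V) h by apply: regularS rh => // y [].
  exists (U `&` V `&` [set y | h y != 0]).
    split; first exact: (zopen_nonvanishing swfX).
    move=> y [[Uy Vy] /= hy]; have Wy : W y by rewrite eW.
    by split=> //=; rewrite eh.
  by rewrite eW in Wx; split=> //=; rewrite -eh // eW.
- move=> W f oW rf x [Wx fx].
  have [U [h [oU Ux rh eh]]] := rf x Wx.
  exists (U `&` [set y | h y != 0]), (fun y => (h y)^-1); split.
  + exact: (zopen_nonvanishing swfX).
  + by split=> //=; rewrite -eh.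
  + exact: (regularV swfX).
  + by move=> y [Wy _] [Uy _]; rewrite eh.
Qed.

(** Nonvanishing loci form a basis. Conversely, the polynomials whose nonvanishing locus lies in [U]
    serve as the defining set. *)
Lemma zopen_affine n (U : set (affine_space K n)) :
  zopen U <-> forall v, U v -> exists p : {mpoly K[n]},
    p.@[(v : 'rV[K]_n) 0] != 0 /\
    forall w, p.@[(w : 'rV[K]_n) 0] != 0 -> U w.
Proof.
split=> [[S ->] v [p Sp pv]|locU].
  by exists p; split=> // w pw; exists p.
exists [set p : {mpoly K[n]} | forall w : 'rV[K]_n, p.@[w 0] != 0 -> U w].
apply/seteqP; split=> [v /locU[p [pv sp]]|v [p sp /sp //]].
by exists p.
Qed.

Lemma zopen_nonzero n (p : {mpoly K[n]}) :
  zopen ([set v | p.@[(v : 'rV[K]_n) 0] != 0] : set (affine_space K n)).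
Proof. by apply/zopen_affine => v pv; exists p. Qed.

Lemma swf_affine n : space_with_functions (affine_space K n).
Proof.
split.
- by apply/zopen_affine => v _; exists 1; rewrite meval1 oner_eq0.
- move=> U V /zopen_affine oU /zopen_affine oV; apply/zopen_affine => v [].
  move=> /oU[p [pv sp]] /oV[q [qv sq]]; exists (p * q).
  rewrite mevalM mulf_neq0 //; split=> // w.
  by rewrite mevalM mulf_eq0 negb_or => /andP[/sp ? /sq].
- move=> F oF; apply/zopen_affine => v [U FU Uv].
  have /zopen_affine/(_ v Uv)[p [pv sp]] := oF _ FU.
  by exists p; split=> // w /sp; exists U.
- move=> U f g _ efg rf v Uv; have [p [q [qv epq]]] := rf v Uv.
  by exists p, q; split=> // w Uw qw; rewrite -efg ?epq.
- move=> F f oF; split=> [rf U FU v Uv|rf v [U FU Uv]].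
    have [|p [q [qv epq]]] := rf v; first by exists U.
    by exists p, q; split=> // w Uw; apply: epq; exists U.
  have [p [q [qv epq]]] := rf U FU v Uv.
  have /zopen_affine/(_ v Uv)[s [sv ss]] := oF _ FU.
  (* The common factor [s] leaves the fraction unchanged and confines its domain to [U], where [epq]
     is valid. *)
  exists (p * s), (q * s); rewrite mevalM mulf_neq0 //; split=> // w _.
  rewrite !mevalM mulf_eq0 negb_or => /andP[qw sw].
  by rewrite epq //; [rewrite -mulf_div divff // mulr1 | exact: ss].
- move=> U c _ v _; exists c%:MP, 1; rewrite meval1 oner_eq0; split=> // w _ _.
  by rewrite mevalC meval1 divr1.
- move=> U f g _ rf rg v Uv.
  have [p [q [qv epq]]] := rf v Uv; have [r [s [sv ers]]] := rg v Uv.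
  exists (p * s + r * q), (q * s); rewrite mevalM mulf_neq0 //; split=> // w Uw.
  rewrite mevalM mulf_eq0 negb_or => /andP[qw sw].
  by rewrite ?mevalD !mevalM epq // ers // addf_div.
- move=> U f g _ rf rg v Uv.
  have [p [q [qv epq]]] := rf v Uv; have [r [s [sv ers]]] := rg v Uv.
  exists (p * r), (q * s); rewrite mevalM mulf_neq0 //; split=> // w Uw.
  rewrite mevalM mulf_eq0 negb_or => /andP[qw sw].
  by rewrite !mevalM epq // ers // mulf_div.
- move=> U f /zopen_affine oU rf; apply/zopen_affine => v [Uv /= fv].
  have [p [q [qv epq]]] := rf v Uv; have [s [sv ss]] := oU v Uv.
  have pv : p.@[(v : 'rV[K]_n) 0] != 0.
    by apply: contraNneq fv => pv; rewrite epq // pv mul0r.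
  exists (p * q * s); rewrite !mevalM !mulf_neq0 //; split=> // w.
  rewrite !mevalM !mulf_eq0 !negb_or => /andP[/andP[pw qw] /ss Uw].
  by split=> //=; rewrite epq // mulf_neq0 ?invr_eq0.
- move=> U f _ rf v [Uv /= fv].
  have [p [q [qv epq]]] := rf v Uv.
  have pv : p.@[(v : 'rV[K]_n) 0] != 0.
    by apply: contraNneq fv => pv; rewrite epq // pv mul0r.
  (* The extra factor [q] in the inverse of [p / q] forces [q] to be nonzero wherever the new
     fraction is evaluated. *)
  exists (q * q), (p * q); rewrite mevalM mulf_neq0 //; split=> // w [Uw /= fw].
  rewrite !mevalM mulf_eq0 negb_or => /andP[pw qw].
  by rewrite epq // invf_div -mulf_div divff // mulr1.
Qed.

(** Topology and functions are defined by pullback along [orbit_of], so each axiom is the same axiom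
    upstairs; [bigE] moves the pullback through unions. *)
Lemma swf_quotient X (e : X -> X -> Prop) :
  space_with_functions X -> space_with_functions (quotient_space e).
Proof.
move=> swfX; pose pr := @orbit_of K X e.
have bigE (F : set (set (orbits e))) : pr @^-1` (\bigcup_(U in F) U) =
    \bigcup_(U in [set pr @^-1` V | V in F]) U.
  apply/seteqP; split=> [x [U FU Ux]|x [_ [V FV <-] Vx]]; last by exists V.
  by exists (pr @^-1` U) => //; exists U.
have oF (F : set (set (orbits e))) : F `<=` @zopen K (quotient_space e) ->
    [set pr @^-1` V | V in F] `<=` @zopen K X.
  by move=> oF _ [V FV <-]; apply: oF.
split.
- exact: (zopenT swfX).
- by move=> U V; exact: (zopenI swfX).
- by move=> F /oF oFX; rewrite /zopen /= -/pr bigE; exact: (zopen_bigcup swfX).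
- by move=> U f g oU efg; apply: (regular_ext swfX) => // x; exact: efg.
- move=> F f /oF oFX; rewrite /regular /= -/pr bigE.
  rewrite (regular_sheaf swfX _ oFX); split=> [rf U FU|rf _ [U FU <-]].
    by apply: rf; exists U.
  exact: rf.
- by move=> U c oU; exact: (regular_cst swfX).
- by move=> U f g oU; exact: (regularD swfX).
- by move=> U f g oU; exact: (regularM swfX).
- by move=> U f oU; exact: (zopen_nonvanishing swfX).
- by move=> U f oU; exact: (regularV swfX).
Qed.

End SpacesWithFunctions.

(** * Morphisms *)

Section RegularMaps.
Variable K : closedFieldType.
Implicit Types X Y Z : fspace K.

Lemma regular_map_comp X Y Z (f : X -> Y) (g : Y -> Z) :
  regular_map f -> regular_map g -> regular_map (g \o f).
Proof.
move=> [of_ rf] [og rg]; split=> [U oU|U h oU rh]; first exact: of_ (og _ oU).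
exact: (rf _ (h \o g) (og _ oU) (rg _ _ oU rh)).
Qed.

Lemma regular_map_cst X Y (y : Y) :
  space_with_functions X -> regular_map ((fun=> y) : X -> Y).
Proof.
move=> swfX; have oC (U : set Y) : zopen ((fun=> y) @^-1` U : set X).
  apply: zopen_local => // x Uy; exists setT.
  by split=> //; exact: (zopenT swfX).
split=> [U _|U h _ _]; first exact: oC.
by apply: (regular_cst swfX); apply: oC.
Qed.

Lemma regular_map_fsubspace X Y (A : set Y) (f : X -> fsubspace A) :
  space_with_functions X -> regular_map (fun x => val (f x) : Y) ->
  regular_map f.
Proof.
move=> swfX [of_ rf].
have oP (W : set (fsubspace A)) : zopen W -> zopen (f @^-1` W).
  by case=> U oU ->; apply: of_.
split=> // W h oW rh; apply: regular_local => //; first exact: oP.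
move=> x Wx; have [U [k [oU Ux rk ek]]] := rh _ Wx.
have oV : zopen (f @^-1` W `&` (fun x => val (f x) : Y) @^-1` U).
  by apply: (zopenI swfX); [exact: oP | exact: of_].
exists (f @^-1` W `&` (fun x => val (f x) : Y) @^-1` U); split=> //.
apply: (regular_ext swfX (f := fun y => k (val (f y)))) => //.
  by move=> y [Wy Uy]; rewrite /= ek.
by apply: (regularS swfX (of_ _ oU) oV _ (rf _ _ oU rk)) => y [].
Qed.

(** Polynomials in the regular components are regular, so basic open sets pull back to open sets and
    fractions to regular functions. *)
Lemma regular_map_affine X n (f : X -> affine_space K n) :
  space_with_functions X ->
  (forall j, regular [set: X] (fun x => (f x : 'rV[K]_n) 0 j)) ->
  regular_map f.
Proof.
move=> swfX rf; have oT := zopenT swfX.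
have rp (p : {mpoly K[n]}) :
    regular [set: X] (fun x => p.@[(f x : 'rV[K]_n) 0]).
  exact: (regular_meval swfX p oT rf).
have oD (p : {mpoly K[n]}) : zopen [set x | p.@[(f x : 'rV[K]_n) 0] != 0].
  by have := zopen_nonvanishing swfX oT (rp p); rewrite setTI.
have oP (U : set (affine_space K n)) : zopen U -> zopen (f @^-1` U).
  move=> /zopen_affine oU; apply: zopen_local => // x /oU[p [px sp]].
  by exists [set x | p.@[(f x : 'rV[K]_n) 0] != 0]; split=> // y /sp.
split=> // U h oU rh; apply: regular_local => //; first exact: oP.
move=> x Ux; have [p [q [qx epq]]] := rh _ Ux.
exists (f @^-1` U `&` [set x | q.@[(f x : 'rV[K]_n) 0] != 0]).
have oV := zopenI swfX (oP _ oU) (oD q).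
split=> //.
apply: (regular_ext swfX (f := fun y =>
    p.@[(f y : 'rV[K]_n) 0] / q.@[(f y : 'rV[K]_n) 0])) => //.
  by move=> y [Uy qy]; rewrite /= epq.
have := regular_div swfX oT (rp p) (rp q); rewrite setTI.
by apply: (regularS swfX (oD q) oV) => y [].
Qed.

Section SubspacesOfAffineSpace.
Variables (n : nat) (A : set (affine_space K n)).
Implicit Types (W : set (fsubspace A)) (f : fsubspace A -> K).

Lemma zopen_subaffine W :
  zopen W <-> forall x, W x -> exists p : {mpoly K[n]},
    p.@[(val x : 'rV[K]_n) 0] != 0 /\
    forall y : fsubspace A, p.@[(val y : 'rV[K]_n) 0] != 0 -> W y.
Proof.
split=> [[U /zopen_affine oU ->] x /oU[p [px sp]]|oW].
  by exists p; split=> // y /sp.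
exists [set v : affine_space K n | exists2 p : {mpoly K[n]},
    (forall y : fsubspace A, p.@[(val y : 'rV[K]_n) 0] != 0 -> W y) &
    p.@[(v : 'rV[K]_n) 0] != 0].
  by exists [set p | forall y : fsubspace A,
    p.@[(val y : 'rV[K]_n) 0] != 0 -> W y].
by apply/seteqP; split=> [x /oW[p [px sp]]|x [p sp /sp //]]; exists p.
Qed.

(** Merges the two local conditions, restriction from an ambient open set and fraction there, into a
    single fraction. *)
Lemma regular_subaffine W f : zopen W ->
  regular W f <-> forall x, W x -> exists p q : {mpoly K[n]},
    q.@[(val x : 'rV[K]_n) 0] != 0 /\
    forall y : fsubspace A, W y -> q.@[(val y : 'rV[K]_n) 0] != 0 ->
      f y = p.@[(val y : 'rV[K]_n) 0] / q.@[(val y : 'rV[K]_n) 0].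
Proof.
move=> oW; split=> [rf x Wx|locf x Wx].
  have [U [h [/zopen_affine oU Ux rh eh]]] := rf x Wx.
  have [s [sx ss]] := oU _ Ux; have [p [q [qx epq]]] := rh _ Ux.
  exists (p * s), (q * s); rewrite mevalM mulf_neq0 //; split=> // y Wy.
  rewrite !mevalM mulf_eq0 negb_or => /andP[qy sy].
  rewrite eh ?epq //; try exact: ss.
  by rewrite -mulf_div divff // mulr1.
have [p [q [qx epq]]] := locf x Wx.
exists [set v : affine_space K n | q.@[(v : 'rV[K]_n) 0] != 0],
  (fun v : affine_space K n => p.@[(v : 'rV[K]_n) 0] / q.@[(v : 'rV[K]_n) 0]).
split=> //; first exact: zopen_nonzero.
by move=> v qv; exists p, q.
Qed.

Lemma regular_meval_subaffine (p : {mpoly K[n]}) :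
  regular setT (fun x : fsubspace A => p.@[(val x : 'rV[K]_n) 0]).
Proof.
apply/regular_subaffine.
  exact: (zopenT (swf_fsubspace _ (@swf_affine K n))).
move=> x _; exists p, 1; rewrite meval1 oner_eq0; split=> // y _ _.
by rewrite meval1 divr1.
Qed.

Lemma regular_map_subaffine m (B : set (affine_space K m))
    (f : fsubspace A -> fsubspace B) (P : 'I_m -> {mpoly K[n]}) :
  (forall x j, (val (f x) : 'rV[K]_m) 0 j = (P j).@[(val x : 'rV[K]_n) 0]) ->
  regular_map f.
Proof.
move=> fP; have swfA := swf_fsubspace A (@swf_affine K n).
apply: regular_map_fsubspace => //; apply: regular_map_affine => // j.
have -> : (fun x => (val (f x) : 'rV[K]_m) 0 j) =
          (fun x => (P j).@[(val x : 'rV[K]_n) 0]) by apply: funext.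
exact: regular_meval_subaffine.
Qed.

End SubspacesOfAffineSpace.

(** Criterion used for every chart: the functions [c] are coordinates on [U], and [g] is a
    parametrization of [U] by [Z]. Being a section of the coordinates and onto [U], [g] is their
    inverse. *)
Lemma affine_chart X n (U : set X) (Z : set (affine_space K n))
    (c : 'I_n -> X -> K) (g : fsubspace Z -> X) :
  space_with_functions X -> zopen U -> zclosed Z ->
  (forall j, regular U (c j)) -> regular_map g -> (forall z, U (g z)) ->
  (forall z j, c j (g z) = (val z : 'rV[K]_n) 0 j) ->
  (forall x, U x -> exists z, g z = x) ->
  affine_variety (fsubspace U).
Proof.
move=> swfX oU cZ rc rg Ug cg gU; exists n, Z; split=> //.
have swfU := swf_fsubspace U swfX.
pose cv (x : X) : affine_space K n := \row_j c j x.
have cvg z : cv (g z) = val z by apply/rowP => j; rewrite mxE cg.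
have Zcv (x : fsubspace U) : Z (cv (val x)).
  by have [z <-] := gU _ (set_valP x); rewrite cvg; exact: set_valP.
pose f (x : fsubspace U) : fsubspace Z := exist _ (cv (val x)) (mem_set (Zcv x)).
pose g' (z : fsubspace Z) : fsubspace U := exist _ (g z) (mem_set (Ug z)).
exists f, g'; split.
- apply: regular_map_fsubspace => //; apply: regular_map_affine => // j x _.
  by exists U, (c j); split=> // [|y _ _]; [exact: set_valP | rewrite mxE].
- by apply: regular_map_fsubspace => //; apply: swf_fsubspace; exact: swf_affine.
- move=> x; apply: val_inj => /=; have [z gz] := gU _ (set_valP x).
  by rewrite -[RHS]gz; congr g; apply: val_inj; rewrite /= -gz cvg.
- by move=> z; apply: val_inj; rewrite /= cvg.
Qed.

(** The point is the equalizer of the identity and a constant map. *)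
Lemma closed_point Y (y : Y) : variety Y -> zclosed [set y].
Proof.
move=> [pY sepY]; have [swfY _] := pY.
by apply: (sepY Y id (fun=> y)) => //; exact: regular_map_cst.
Qed.

Section Orbits.
Variables (X : fspace K) (e : X -> X -> Prop).

Definition orbit_rep (O : quotient_space e) : X := projT1 (cid (proj2_sig O)).

Lemma orbit_repK O : orbit_of e (orbit_rep O) = O.
Proof.
case: O => O xO; apply: eq_exist; rewrite /orbit_rep.
by case: cid => x /= ->.
Qed.

Hypotheses (e_refl : forall x, e x x) (e_sym : forall x y, e x y -> e y x)
  (e_trans : forall x y z, e x y -> e y z -> e x z).

Lemma orbit_ofE x y : orbit_of e x = orbit_of e y <-> e x y.
Proof.
split=> [[exy]|exy]; first by rewrite exy.
apply: eq_exist; apply/seteqP; split=> z; last exact: e_trans.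
by apply: e_trans; exact: e_sym.
Qed.

End Orbits.

End RegularMaps.

Lemma ord3_cases (i : 'I_3) : [\/ i = o3 0, i = o3 1 | i = o3 2].
Proof.
by case: i => [[|[|[|//]]] i]; [apply: Or31|apply: Or32|apply: Or33]; apply: val_inj.
Qed.

Lemma ord4_cases (i : 'I_4) : (i = o4 0 \/ i = o4 1) \/ (i = o4 2 \/ i = o4 3).
Proof.
case: i => [[|[|[|[|//]]]] i]; [left; left|left; right|right; left|right; right];
  exact: val_inj.
Qed.

(** * The weighted projective plane *)

Section CP112.
Variable K : closedFieldType.

Definition row3 (x y z : K) : 'rV[K]_3 := \row_j [:: x; y; z]`_j.

Lemma row3P (v w : 'rV[K]_3) : v 0 (o3 0) = w 0 (o3 0) ->
  v 0 (o3 1) = w 0 (o3 1) -> v 0 (o3 2) = w 0 (o3 2) -> v = w.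
Proof. by move=> e0 e1 e2; apply/rowP => j; case: (ord3_cases j) => ->. Qed.

Lemma sqrt_exists (c : K) : exists m : K, m ^+ 2 = c.
Proof.
(* The list holds the lower coefficients of the monic equation m^2 = c + 0 m. *)
have [m mE] := @solve_monicpoly K 2 (fun i => [:: c; 0]`_i) isT.
by exists m; rewrite mE !big_ord_recl big_ord0 /=; ring.
Qed.

Lemma row3_neq0 (v : 'rV[K]_3) : v != 0 ->
  [\/ v 0 (o3 0) != 0, v 0 (o3 1) != 0 | v 0 (o3 2) != 0].
Proof.
move=> v0; have [e0|?] := eqVneq (v 0 (o3 0)) 0; last exact: Or31.
have [e1|?] := eqVneq (v 0 (o3 1)) 0; last exact: Or32.
have [e2|?] := eqVneq (v 0 (o3 2)) 0; last exact: Or33.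
by case/eqP: v0; apply: row3P; rewrite mxE.
Qed.

Definition punctured : fspace K :=
  fsubspace [set v : affine_space K 3 | (v : 'rV[K]_3) != 0].

Lemma swf_punctured : space_with_functions punctured.
Proof. exact: swf_fsubspace (@swf_affine K 3). Qed.

Definition vec (x : punctured) : 'rV[K]_3 := val x.

Lemma vec_neq0 x : vec x != 0. Proof. exact: (set_valP x). Qed.

Definition mk_punctured (v : 'rV[K]_3) (v0 : v != 0) : punctured :=
  exist _ (v : affine_space K 3) (mem_set v0).

Lemma vec_mk v (v0 : v != 0) : vec (mk_punctured v0) = v.
Proof. by []. Qed.

(** Convertible to the relation inside [CP112], so that [cls] has the right target by mere
    typing. *)
Definition weighted_orbit (x y : punctured) : Prop :=
  exists2 l : K, l != 0 & (val y : 'rV[K]_3) =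
    \row_j (l ^+ nth 0%N [:: 1; 1; 2]%N j * (val x : 'rV[K]_3) 0 j).

Lemma weighted_orbitP x y : weighted_orbit x y <->
  exists2 l : K, l != 0 & [/\ vec y 0 (o3 0) = l * vec x 0 (o3 0),
    vec y 0 (o3 1) = l * vec x 0 (o3 1) &
    vec y 0 (o3 2) = l ^+ 2 * vec x 0 (o3 2)].
Proof.
split=> [[l l0 e]|[l l0 [e0 e1 e2]]]; exists l => //.
  by rewrite /vec e !mxE.
by apply: row3P; rewrite mxE.
Qed.

Lemma weighted_orbit_refl x : weighted_orbit x x.
Proof.
by apply/weighted_orbitP; exists 1; rewrite ?oner_eq0 // expr1n !mul1r.
Qed.

Lemma weighted_orbit_sym x y : weighted_orbit x y -> weighted_orbit y x.
Proof.
move=> /weighted_orbitP[l l0 [e0 e1 e2]]; apply/weighted_orbitP; exists l^-1.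
  by rewrite invr_eq0.
by rewrite e0 e1 e2 exprVn !mulKf // expf_neq0.
Qed.

Lemma weighted_orbit_trans x y z :
  weighted_orbit x y -> weighted_orbit y z -> weighted_orbit x z.
Proof.
move=> /weighted_orbitP[l l0 [e0 e1 e2]] /weighted_orbitP[m m0 [f0 f1 f2]].
apply/weighted_orbitP; exists (m * l); first by rewrite mulf_neq0.
by rewrite f0 f1 f2 e0 e1 e2 exprMn !mulrA.
Qed.

Definition cls : punctured -> CP112 K := @orbit_of K punctured weighted_orbit.

Definition rep : CP112 K -> punctured := @orbit_rep K punctured weighted_orbit.

Lemma repK O : cls (rep O) = O.
Proof. exact: orbit_repK. Qed.

Lemma clsE x y : cls x = cls y <-> weighted_orbit x y.
Proof.
apply: orbit_ofE; [exact: weighted_orbit_refl | exact: weighted_orbit_sym |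
  exact: weighted_orbit_trans].
Qed.

Lemma rep_cls x : weighted_orbit x (rep (cls x)).
Proof. by apply/clsE; rewrite repK. Qed.

Lemma swf_CP112 : space_with_functions (CP112 K).
Proof. exact: swf_quotient swf_punctured. Qed.

Lemma zopen_CP112 (W : set (CP112 K)) : zopen W <-> zopen (cls @^-1` W).
Proof. by []. Qed.

Lemma regular_CP112 (W : set (CP112 K)) (f : CP112 K -> K) :
  regular W f <-> regular (cls @^-1` W) (f \o cls).
Proof. by []. Qed.

(* The degree 2 monomials embed CP112 in CP_3 as a quadric cone. *)
Definition quad (k : 'I_4) : {mpoly K[3]} :=
  [:: 'X_(o3 0) ^+ 2; 'X_(o3 0) * 'X_(o3 1); 'X_(o3 1) ^+ 2; 'X_(o3 2)]`_k.

Definition qv (x : punctured) (k : 'I_4) : K := (quad k).@[vec x 0].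

Lemma qvE x : [/\ qv x (o4 0) = vec x 0 (o3 0) ^+ 2,
  qv x (o4 1) = vec x 0 (o3 0) * vec x 0 (o3 1),
  qv x (o4 2) = vec x 0 (o3 1) ^+ 2 & qv x (o4 3) = vec x 0 (o3 2)].
Proof. by rewrite /qv /quad /= !expr2 !mevalM !mevalXU. Qed.

(** All four monomials have weighted degree 2, hence the common factor [l ^+ 2]. *)
Lemma qv_orbit x y : weighted_orbit x y ->
  exists2 l : K, l != 0 & forall k, qv y k = l * qv x k.
Proof.
move=> /weighted_orbitP[l l0 [e0 e1 e2]]; exists (l ^+ 2).
  by rewrite expf_neq0.
have [x0 x1 x2 x3] := qvE x; have [y0 y1 y2 y3] := qvE y.
move=> k; case: (ord4_cases k) => [[]|[]] ->;
  rewrite ?(x0, x1, x2, x3, y0, y1, y2, y3, e0, e1, e2) //; ring.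
Qed.

Lemma qv_neq0 x :
  [\/ qv x (o4 0) != 0, qv x (o4 2) != 0 | qv x (o4 3) != 0].
Proof.
have [-> _ -> ->] := qvE x; rewrite !expf_eq0 /=.
exact: row3_neq0 (vec_neq0 x).
Qed.

(** Injectivity of the quadric cone embedding. If the quadratic vectors are proportional by [c], the
    scalar sought is a square root of [c] with the right sign. The ratio of two nonzero first
    coordinates is such a root, and the mixed monomial shows that it also fits the second
    coordinate; when the first coordinates vanish, the second ones fix the sign, or any root will
    do. *)
Lemma qv_inj x y :
  (forall k l, qv x k * qv y l = qv x l * qv y k) -> weighted_orbit x y.
Proof.
move=> exy.
have [k yk] : exists k, qv y k != 0.
  by case: (qv_neq0 y) => ?; [exists (o4 0) | exists (o4 2) | exists (o4 3)].
pose c := qv x k / qv y k.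
have qc l : qv x l = c * qv y l.
  by apply: (mulIf yk); rewrite exy /c mulrAC divfK.
have c0 : c != 0.
  by apply/eqP => c0; case: (qv_neq0 x); rewrite qc c0 mul0r eqxx.
suff : exists2 m : K, m != 0 & [/\ m ^+ 2 = c,
    vec x 0 (o3 0) = m * vec y 0 (o3 0) & vec x 0 (o3 1) = m * vec y 0 (o3 1)].
  move=> [m m0 [mc e0 e1]]; apply: weighted_orbit_sym; apply/weighted_orbitP.
  exists m => //; split=> //; rewrite mc.
  by have [_ _ _ <-] := qvE x; have [_ _ _ <-] := qvE y.
have [x0 x1 x2 _] := qvE x; have [y0 y1 y2 _] := qvE y.
have := qc (o4 0); have := qc (o4 1); have := qc (o4 2).
rewrite x0 x1 x2 y0 y1 y2.
move: (vec x 0 _) (vec x 0 _) (vec y 0 _) (vec y 0 _) => a b a' b'.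
move=> e2 e1 e0.
have [a'0|a'0] := eqVneq a' 0.
  have a0 : a = 0.
    by apply/eqP; rewrite -sqrf_eq0 e0 a'0 expr0n mulr0.
  have [b'0|b'0] := eqVneq b' 0.
    have b0 : b = 0 by apply/eqP; rewrite -sqrf_eq0 e2 b'0 expr0n mulr0.
    have [m mc] := sqrt_exists c; exists m; first by rewrite -sqrf_eq0 mc.
    by rewrite a0 b0 a'0 b'0 !mulr0.
  exists (b / b').
    rewrite -sqrf_eq0 expr_div_n e2 mulfK ?sqrf_eq0 //.
  by rewrite expr_div_n e2 mulfK ?sqrf_eq0 // a0 a'0 mulr0 divfK.
have aa : (a / a') ^+ 2 = c by rewrite expr_div_n e0 mulfK // sqrf_eq0.
have a0 : a != 0.
  by apply: contraNneq c0 => a0; rewrite -aa a0 mul0r expr0n.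
exists (a / a'); first by rewrite mulf_neq0 ?invr_eq0.
split=> //; first by rewrite divfK.
by apply: (mulfI a0); rewrite e1 -aa; field.
Qed.

(** Evaluated at the chosen representative, here and in [quad_ratio]; independence of the choice is
    [chart_domain_cls] and [quad_ratio_cls]. *)
Definition chart_domain (i : 'I_4) : set (CP112 K) :=
  [set O | qv (rep O) i != 0].

Definition quad_ratio (i k : 'I_4) (O : CP112 K) : K :=
  qv (rep O) k / qv (rep O) i.

Lemma chart_domain_cls i x : chart_domain i (cls x) = (qv x i != 0).
Proof.
rewrite /chart_domain /=; have [l l0 ->] := qv_orbit (rep_cls x).
by rewrite mulf_eq0 (negbTE l0).
Qed.

Lemma quad_ratio_cls i k x : quad_ratio i k (cls x) = qv x k / qv x i.
Proof.
rewrite /quad_ratio; have [l l0 e] := qv_orbit (rep_cls x).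
by rewrite !e -mulf_div divff // mul1r.
Qed.

Lemma zopen_chart_domain i : zopen (chart_domain i).
Proof.
apply/zopen_CP112.
have -> : cls @^-1` chart_domain i = [set x | qv x i != 0].
  by apply: funext => x; exact: chart_domain_cls.
apply/zopen_subaffine => x xi; exists (quad i); split=> //.
Qed.

Lemma regular_quad_ratio i k : regular (chart_domain i) (quad_ratio i k).
Proof.
apply/regular_CP112.
have -> : quad_ratio i k \o cls = (fun x => qv x k / qv x i).
  by apply: funext => x; exact: quad_ratio_cls.
apply/regular_subaffine; first exact: zopen_chart_domain.
move=> x xi; exists (quad k), (quad i); split=> //.
by move: xi; rewrite /= chart_domain_cls.
Qed.

(** Where [f] and [g] differ, [qv_inj] yields a nonzero 2 by 2 minor of the two quadratic vectors.
    Normalized by chart coordinates, it is a regular function near the point that vanishes wherever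
    [f] and [g] agree. *)
Lemma separated_CP112 : separated (CP112 K).
Proof.
move=> Y f g [swfY _] [of_ rf] [og rg]; rewrite /zclosed.
apply: zopen_local => // y fgy.
have [i fi] : exists i, qv (rep (f y)) i != 0.
  by case: (qv_neq0 (rep (f y))) => ?; [exists (o4 0)|exists (o4 2)|exists (o4 3)].
have [j gj] : exists j, qv (rep (g y)) j != 0.
  by case: (qv_neq0 (rep (g y))) => ?; [exists (o4 0)|exists (o4 2)|exists (o4 3)].
have [k [l kl]] : exists k l, qv (rep (f y)) k * qv (rep (g y)) l !=
    qv (rep (f y)) l * qv (rep (g y)) k.
  apply: contrapT => nkl; apply: fgy; rewrite /= -[f y]repK -[g y]repK.
  apply/clsE/qv_inj => k l; apply/eqP/negPn/negP => kl.
  by apply: nkl; exists k, l.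
pose U := f @^-1` chart_domain i `&` g @^-1` chart_domain j.
have ofi := of_ _ (zopen_chart_domain i); have ogj := og _ (zopen_chart_domain j).
have oU : zopen U by exact: (zopenI swfY).
have rfU m : regular U (quad_ratio i m \o f).
  apply: (regularS swfY ofi oU) => [z []//|].
  exact: (rf _ _ (zopen_chart_domain i) (@regular_quad_ratio i m)).
have rgU m : regular U (quad_ratio j m \o g).
  apply: (regularS swfY ogj oU) => [z []//|].
  exact: (rg _ _ (zopen_chart_domain j) (@regular_quad_ratio j m)).
pose d z := quad_ratio i k (f z) * quad_ratio j l (g z) +
  (-1) * (quad_ratio i l (f z) * quad_ratio j k (g z)).
have rd : regular U d.
  apply: (regularD swfY oU); first exact: (regularM swfY oU (rfU k) (rgU l)).
  apply: (regularM swfY oU); first exact: (regular_cst swfY).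
  exact: (regularM swfY oU (rfU l) (rgU k)).
exists (U `&` [set z | d z != 0]); split.
- exact: (zopen_nonvanishing swfY oU rd).
- split=> //=; rewrite /d /quad_ratio mulN1r subr_eq0 !mulf_div.
  by rewrite (inj_eq (divIf _)) // mulf_neq0.
- move=> z [_ + efg]; apply/negP; rewrite negbK /d [f z]efg /quad_ratio mulN1r.
  by rewrite !mulf_div subr_eq0 (mulrC (qv _ k)).
Qed.

End CP112.

(** * The three affine charts of the weighted projective plane *)

Section Charts.
Variable K : closedFieldType.

(** On a lift normalized by [qv x i = 1] the ratios are the quadratic monomials themselves. The lift
    is only asked to exist pointwise, since over the cone it is a choice of square roots. *)
Lemma section_chart i n (Z : set (affine_space K n)) (c : 'I_n -> 'I_4)
    (g : fsubspace Z -> CP112 K) : zclosed Z -> regular_map g ->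
  (forall z, exists x, [/\ cls x = g z, qv x i = 1 &
     forall j, qv x (c j) = (val z : 'rV[K]_n) 0 j]) ->
  (forall x, qv x i != 0 -> exists z, g z = cls x) ->
  affine_variety (fsubspace (@chart_domain K i)).
Proof.
move=> cZ rg gP surj.
apply: (affine_chart (c := fun j => quad_ratio i (c j)) (g := g)) => //.
- exact: swf_CP112.
- exact: zopen_chart_domain.
- by move=> j; exact: regular_quad_ratio.
- by move=> z; have [x [<- xi _]] := gP z; rewrite chart_domain_cls xi oner_eq0.
- by move=> z j; have [x [<- xi xj]] := gP z; rewrite quad_ratio_cls xi xj divr1.
- by move=> O; rewrite -[O]repK chart_domain_cls => /surj.
Qed.

Lemma regular_map_cls : regular_map (@cls K).
Proof. by []. Qed.

Let plane := fsubspace [set: affine_space K 2].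
Let coord (z : plane) (k : 'I_2) : K := (val z : 'rV[K]_2) 0 k.

Lemma affine_chart0 : affine_variety (fsubspace (@chart_domain K (o4 0))).
Proof.
pose r (z : plane) : 'rV[K]_3 := row3 1 (coord z (o2 0)) (coord z (o2 1)).
have r0 z : r z != 0.
  by apply/eqP => /rowP/(_ (o3 0))/eqP; rewrite !mxE oner_eq0.
(* On the slice x = 1 the monomials xy and z restrict to the two coordinates of the plane. *)
apply: (section_chart (c := fun j => [:: o4 1; o4 3]`_j)
  (g := fun z => cls (mk_punctured (r0 z)))).
- by rewrite /zclosed setCT; apply: zopen0; exact: swf_affine.
- apply: regular_map_comp regular_map_cls.
  apply: (regular_map_subaffine
    (P := fun j => [:: 1; 'X_(o2 0); 'X_(o2 1)]`_j)) => z j.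
  by case: (ord3_cases j) => ->; rewrite mxE /= ?meval1 ?mevalXU.
- move=> z; exists (mk_punctured (r0 z)); split=> //.
    by have [-> _ _ _] := qvE (mk_punctured (r0 z)); rewrite vec_mk mxE expr1n.
  have [_ e1 _ e3] := qvE (mk_punctured (r0 z)).
  case=> [[|[|//]] j]; rewrite /= ?e1 ?e3 vec_mk !mxE /= ?mul1r /coord;
    by congr (val z _ _); apply: val_inj.
- move=> x; have [-> _ _ _] := qvE x; rewrite sqrf_eq0 => x0.
  pose z : plane := exist _ (\row_(j < 2) [:: vec x 0 (o3 1) / vec x 0 (o3 0);
    vec x 0 (o3 2) / vec x 0 (o3 0) ^+ 2]`_j : affine_space K 2) (mem_set I).
  exists z; apply/clsE/weighted_orbitP; exists (vec x 0 (o3 0)) => //.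
  rewrite vec_mk !mxE /= /coord /= !mxE /=.
  by split; first [by rewrite ?mulr1 | field].
Qed.

Lemma affine_chart2 : affine_variety (fsubspace (@chart_domain K (o4 2))).
Proof.
pose r (z : plane) : 'rV[K]_3 := row3 (coord z (o2 0)) 1 (coord z (o2 1)).
have r0 z : r z != 0.
  by apply/eqP => /rowP/(_ (o3 1))/eqP; rewrite !mxE oner_eq0.
apply: (section_chart (c := fun j => [:: o4 1; o4 3]`_j)
  (g := fun z => cls (mk_punctured (r0 z)))).
- by rewrite /zclosed setCT; apply: zopen0; exact: swf_affine.
- apply: regular_map_comp regular_map_cls.
  apply: (regular_map_subaffine
    (P := fun j => [:: 'X_(o2 0); 1; 'X_(o2 1)]`_j)) => z j.
  by case: (ord3_cases j) => ->; rewrite mxE /= ?meval1 ?mevalXU.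
- move=> z; exists (mk_punctured (r0 z)); split=> //.
    by have [_ _ -> _] := qvE (mk_punctured (r0 z)); rewrite vec_mk mxE expr1n.
  have [_ e1 _ e3] := qvE (mk_punctured (r0 z)).
  case=> [[|[|//]] j]; rewrite /= ?e1 ?e3 vec_mk !mxE /= ?mulr1 /coord;
    by congr (val z _ _); apply: val_inj.
- move=> x; have [_ _ -> _] := qvE x; rewrite sqrf_eq0 => x1.
  pose z : plane := exist _ (\row_(j < 2) [:: vec x 0 (o3 0) / vec x 0 (o3 1);
    vec x 0 (o3 2) / vec x 0 (o3 1) ^+ 2]`_j : affine_space K 2) (mem_set I).
  exists z; apply/clsE/weighted_orbitP; exists (vec x 0 (o3 1)) => //.
  rewrite vec_mk !mxE /= /coord /= !mxE /=.
  by split; first [by rewrite ?mulr1 | field].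
Qed.

(** * The singular chart as a quadric cone *)

Definition cone_eq : {mpoly K[3]} := 'X_(o3 0) * 'X_(o3 2) - 'X_(o3 1) ^+ 2.

Definition cone : set (affine_space K 3) :=
  [set v | cone_eq.@[(v : 'rV[K]_3) 0] = 0].

Definition cone_vec (z : fsubspace cone) : 'rV[K]_3 := val z.

(* [cone_lift x z]: x lies on the section Z2 = 1 of the weighted cone, which is
   the double cover of the chart Z2 != 0. *)
Definition cone_lift (x : punctured K) (z : fsubspace cone) : Prop :=
  vec x 0 (o3 2) = 1 /\ cone_vec z = row3 (vec x 0 (o3 0) ^+ 2)
    (vec x 0 (o3 0) * vec x 0 (o3 1)) (vec x 0 (o3 1) ^+ 2).

Lemma coneP (v : 'rV[K]_3) :
  cone v <-> v 0 (o3 0) * v 0 (o3 2) = v 0 (o3 1) ^+ 2.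
Proof.
rewrite /cone /= /cone_eq expr2 mevalB !mevalM !mevalXU -expr2.
by split=> [/eqP|->]; [rewrite subr_eq0 => /eqP | rewrite subrr].
Qed.

(** A root x of the first coordinate is taken. If it is nonzero, the middle coordinate divided by x
    is a root of the last one with the right sign; otherwise the cone equation kills the middle
    coordinate and any root of the last one fits. *)
Lemma cone_lift_exists z : exists x, cone_lift x z.
Proof.
have /coneP := set_valP z; rewrite -/(cone_vec z); set v := cone_vec z => vE.
suff [x [y [ex exy ey]]] : exists x y : K, [/\ x ^+ 2 = v 0 (o3 0),
    x * y = v 0 (o3 1) & y ^+ 2 = v 0 (o3 2)].
  have r0 : row3 x y 1 != 0.
    by apply/eqP => /rowP/(_ (o3 2))/eqP; rewrite !mxE oner_eq0.
  exists (mk_punctured r0); split; first by rewrite vec_mk mxE.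
  by rewrite vec_mk !mxE /= ex exy ey; apply: row3P; rewrite mxE.
have [x ex] := sqrt_exists (v 0 (o3 0)).
have [x0|x0] := eqVneq x 0.
  have [y ey] := sqrt_exists (v 0 (o3 2)); exists x, y; split=> //.
  rewrite x0 mul0r; apply/esym/eqP.
  by rewrite -sqrf_eq0 -vE -ex x0 expr0n mul0r.
exists x, (v 0 (o3 1) / x); split=> //; first by rewrite mulrC divfK.
by rewrite expr_div_n -vE ex mulrC mulKf // -ex expf_neq0.
Qed.

(** Chosen point by point, with no regularity claimed; only its class is shown to be regular, in
    [regular_map_cone]. *)
Definition cone_section (z : fsubspace cone) : punctured K :=
  projT1 (cid (cone_lift_exists z)).

Lemma cone_sectionP z : cone_lift (cone_section z) z.
Proof. by rewrite /cone_section; case: cid. Qed.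

Lemma cone_lift_qv x z : cone_lift x z -> qv x (o4 3) = 1 /\
  forall j : 'I_3, qv x (widen_ord (leqnSn 3) j) = cone_vec z 0 j.
Proof.
move=> [x2 ->]; have [e0 e1 e2 e3] := qvE x; split; first by rewrite e3.
move=> j; have -> : widen_ord (leqnSn 3) j = [:: o4 0; o4 1; o4 2]`_j.
  by case: (ord3_cases j) => -> /=; apply: val_inj.
by case: (ord3_cases j) => ->; rewrite mxE /=.
Qed.

(** The action of the scalar -1, which is the covering involution of the slice. *)
Definition negp (x : punctured K) : 'rV[K]_3 :=
  row3 (- vec x 0 (o3 0)) (- vec x 0 (o3 1)) (vec x 0 (o3 2)).

Lemma negp_neq0 x : negp x != 0.
Proof.
apply: contra (vec_neq0 x) => /eqP/rowP nx; apply/eqP; apply: row3P; rewrite mxE.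
- by have /eqP := nx (o3 0); rewrite !mxE oppr_eq0 => /eqP.
- by have /eqP := nx (o3 1); rewrite !mxE oppr_eq0 => /eqP.
- by have := nx (o3 2); rewrite !mxE.
Qed.

Definition opposite x : punctured K := mk_punctured (negp_neq0 x).

Lemma cls_opposite x : cls (opposite x) = cls x.
Proof.
apply/clsE/weighted_orbitP; exists (- 1); rewrite ?oppr_eq0 ?oner_eq0 //.
by rewrite vec_mk !mxE /= !mulN1r !opprK sqrrN expr1n mul1r.
Qed.

(** Symmetrization cancels the monomials of odd degree in the first two variables and doubles the
    others, which are polynomials in x^2, xy and y^2. The third variable equals 1 on a lift. *)
Lemma even_part (p : {mpoly K[3]}) : exists P : {mpoly K[3]},
  forall x z, cone_lift x z ->
    p.@[vec x 0] + p.@[vec (opposite x) 0] = P.@[cone_vec z 0].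
Proof.
elim/mpolyind: p => [|c m p _ _ [P PE]].
  by exists 0 => x z _; rewrite !meval0 addr0.
pose i := m (o3 0); pose j := m (o3 1).
(* When [i] and [j] have the same parity, the pairs left over from the two halvings form one factor
   xy or none. *)
pose M : {mpoly K[3]} := if odd (i + j) then 0 else
  (1 + 1) * ('X_(o3 0) ^+ i./2 * 'X_(o3 1) ^+ odd i * 'X_(o3 2) ^+ j./2).
exists (c *: M + P) => x z xz; have [x2 zE] := xz.
rewrite !mevalD !mevalZ -(PE x z xz) addrACA -mulrDr; congr (_ * _ + _).
rewrite !mevalX !big_ord_recl !big_ord0.
have -> : lift ord0 (lift ord0 ord0) = o3 2 by apply: val_inj.
have -> : lift ord0 ord0 = o3 1 by apply: val_inj.
have -> : ord0 = o3 0 by apply: val_inj.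
rewrite vec_mk !mxE /= x2 expr1n !mulr1 -/i -/j.
rewrite -[- vec x 0 (o3 0)]mulN1r -[- vec x 0 (o3 1)]mulN1r !exprMn mulrACA.
rewrite -exprD -signr_odd /M; have [_|oij] := ifPn.
  by rewrite meval0 mulN1r subrr.
rewrite expr0 mul1r !mevalM mevalD !meval1 !rmorphXn /= !mevalXU zE !mxE /=.
rewrite mulrDl mul1r; suff -> : vec x 0 (o3 0) ^+ i * vec x 0 (o3 1) ^+ j =
  (vec x 0 (o3 0) ^+ 2) ^+ i./2 * (vec x 0 (o3 0) * vec x 0 (o3 1)) ^+ odd i *
  (vec x 0 (o3 1) ^+ 2) ^+ j./2 by [].
have eij : odd j = odd i by move: oij; rewrite oddD; do 2!case: odd.
rewrite -[in LHS](odd_double_half i) -[in LHS](odd_double_half j) eij -!addnn.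
by rewrite !exprD !expr2 !exprMn; ring.
Qed.

(** A multiplier [r] protects the symmetrization from vanishing at [x]. If none did, r = 1 would
    make [p] change sign between [x] and its opposite, and the coordinate functions would then force
    the two points to coincide, whence 2 p(x) = 0. *)
Lemma even_part_neq0 x (p : {mpoly K[3]}) : 2%:R != 0 :> K ->
  p.@[vec x 0] != 0 -> exists r : {mpoly K[3]},
    (p * r).@[vec x 0] + (p * r).@[vec (opposite x) 0] != 0.
Proof.
move=> K2 px; apply: contrapT => nr.
have e r : (p * r).@[vec x 0] + (p * r).@[vec (opposite x) 0] = 0.
  by apply/eqP/negPn/negP => h; apply: nr; exists r.
have po : p.@[vec (opposite x) 0] = - p.@[vec x 0].
  by have /eqP := e 1; rewrite mulr1 addr_eq0 => /eqP ->; rewrite opprK.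
have e2 k : p.@[vec x 0] * (vec x 0 k - vec (opposite x) 0 k) = 0.
  by rewrite -(e 'X_k) !mevalM !mevalXU po mulrBr mulNr.
have xo k : vec x 0 k = vec (opposite x) 0 k.
  by apply/eqP; have /eqP := e2 k; rewrite mulf_eq0 (negbTE px) subr_eq0.
have /eqP := e 1.
rewrite mulr1 -(meval_eq _ xo) -mulr2n -mulr_natr mulf_eq0.
by rewrite (negbTE px) (negbTE K2).
Qed.

Lemma zclosed_cone : zclosed cone.
Proof.
have -> : cone = ~` [set v | cone_eq.@[(v : 'rV[K]_3) 0] != 0].
  apply/seteqP; split=> v; rewrite /cone /=.
    by move=> -> /eqP.
  by move/negP/negPn/eqP.
by rewrite /zclosed setCK; exact: zopen_nonzero.
Qed.

(** Polynomials upstairs become polynomials on the cone by adding their values at the two lifts. A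
    function on classes agrees at both lifts, so an identity f q = p, multiplied by suitable
    factors, survives the addition. *)
Lemma regular_map_cone : 2%:R != 0 :> K ->
  regular_map (fun z => cls (cone_section z)).
Proof.
move=> K2; pose s := cone_section; pose g z := cls (s z).
have oP (W : set (CP112 K)) : zopen W -> zopen (g @^-1` W).
  move=> /zopen_CP112/zopen_subaffine oW; apply/zopen_subaffine => z Wz.
  have [p [ps sp]] := oW (s z) Wz; have [r rs] := even_part_neq0 K2 ps.
  have [P PE] := even_part (p * r).
  exists P; split; first by rewrite -(PE (s z) z (cone_sectionP z)).
  move=> y; rewrite -[val y]/(cone_vec y) -(PE (s y) y (cone_sectionP y)) => Py.
  (* A nonzero sum means that [p] is nonzero at one of the two lifts, and both have the same
     class. *)
  have [py|py] := eqVneq (p.@[vec (s y) 0]) 0; last exact: sp.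
  rewrite /g /= -cls_opposite; apply: sp; apply: contraNneq Py => pny.
  by rewrite !mevalM py mul0r add0r [X in X * _]pny mul0r.
split=> // W f oW rf; apply/regular_subaffine; first exact: oP.
move=> z Wz; have /zopen_CP112 oW' := oW.
have /regular_CP112/(regular_subaffine _ oW')/(_ (s z) Wz) := rf.
move=> [p [q [qs fE]]].
(* The additional factor [q] makes the identity hold also where [q] vanishes, which may happen at
   the opposite lift. *)
have fq y : W (cls y) -> f (cls y) * (q * q).@[vec y 0] = (p * q).@[vec y 0].
  move=> Wy; rewrite !mevalM; have [->|qy] := eqVneq q.@[vec y 0] 0.
    by rewrite !mulr0.
  by have /= -> := fE y Wy qy; rewrite mulrA divfK.
have qqs : (q * q).@[vec (s z) 0] != 0 by rewrite mevalM mulf_neq0.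
have [r rs] := even_part_neq0 K2 qqs.
have [P PE] := even_part (p * q * r); have [Q QE] := even_part (q * q * r).
exists P, Q; split; first by rewrite -(QE (s z) z (cone_sectionP z)).
move=> y Wy; rewrite -[val y]/(cone_vec y) => Qy.
apply: (mulIf Qy); rewrite divfK //.
rewrite -(QE _ _ (cone_sectionP y)) -(PE _ _ (cone_sectionP y)) mulrDr.
rewrite (mevalM _ (q * q) r) (mevalM _ (p * q) r) mulrA -/s.
rewrite (mevalM _ (q * q) r) (mevalM _ (p * q) r) mulrA -/s.
rewrite -fq // -(fq (opposite (s y))) ?cls_opposite //.
Qed.

Lemma affine_chart3 : 2%:R != 0 :> K ->
  affine_variety (fsubspace (@chart_domain K (o4 3))).
Proof.
move=> K2; apply: (section_chart (c := widen_ord (leqnSn 3)) (g :=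
   fun z => cls (cone_section z))).
- exact: zclosed_cone.
- exact: regular_map_cone.
- move=> z; exists (cone_section z).
  by have [] := cone_lift_qv (cone_sectionP z).
- move=> x x3.
  pose v : 'rV[K]_3 := \row_j (qv x (widen_ord (leqnSn 3) j) / qv x (o4 3)).
  have vE k l : l = widen_ord (leqnSn 3) k -> v 0 k = qv x l / qv x (o4 3).
    by rewrite mxE => ->.
  have [e0 e1 e2 e3] := qvE x.
  have conev : cone v.
    apply/coneP.
    rewrite (vE (o3 0) (o4 0)) ?(vE (o3 1) (o4 1)) ?(vE (o3 2) (o4 2));
      try exact: val_inj.
    by rewrite e0 e1 e2; field.
  pose z : fsubspace cone := exist _ (v : affine_space K 3) (mem_set conev).
  (* Every lift of [v] has quadratic vector proportional to that of [x], so the sign chosen by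
     [cone_section] is immaterial. *)
  exists z; apply/clsE/qv_inj.
  have [z3 zE] := cone_lift_qv (cone_sectionP z).
  have qz k : qv (cone_section z) k = qv x k / qv x (o4 3).
    have [->|] := eqVneq k (o4 3); first by rewrite z3 divff.
    case: (unliftP (o4 3) k) => [j ->|-> /eqP //] _.
    have -> : lift (o4 3) j = widen_ord (leqnSn 3) j.
      by apply: val_inj; rewrite /= /bump leqNgt ltn_ord.
    by rewrite zE /cone_vec /= mxE.
  by move=> k l; rewrite !qz mulrAC [RHS]mulrAC (mulrC (qv x k)).
Qed.

Lemma variety_CP112 : 2%:R != 0 :> K -> variety (CP112 K).
Proof.
move=> K2; split; last exact: separated_CP112.
split; first exact: swf_CP112.
exists 3, (fun i => @chart_domain K ([:: o4 0; o4 2; o4 3]`_i)); split.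
- by move=> i; exact: zopen_chart_domain.
- move=> O; case: (qv_neq0 (rep O)) => ?;
    by [exists (o3 0) | exists (o3 1) | exists (o3 2)].
- move=> i; case: (ord3_cases i) => ->.
  + exact: affine_chart0.
  + exact: affine_chart2.
  + exact: affine_chart3.
Qed.

End Charts.

(** * Zariski closed subsets of lines *)

Section Lines.
Variable K : closedFieldType.

Lemma meval_line n (p : {mpoly K[n]}) (u w : 'rV[K]_n) :
  exists P : {poly K}, forall s, p.@[(u + s *: w) 0] = P.[s].
Proof.
exists (\sum_(m <- msupp p) (p@_m)%:P *
  \prod_i ((u 0 i)%:P + 'X * (w 0 i)%:P) ^+ m i) => s.
rewrite mevalE horner_sum; apply: eq_bigr => m _.
rewrite hornerM hornerC horner_prod; congr (_ * _); apply: eq_bigr => i _.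
by rewrite horner_exp !hornerE !mxE.
Qed.

Lemma exists_nonzero_nonroot (P : {poly K}) :
  P != 0 -> exists2 s : K, s != 0 & P.[s] != 0.
Proof.
move=> P0; have : P * 'X != 0 by rewrite mulf_neq0 ?polyX_eq0.
move=> /closed_nonrootP[s]; rewrite rootM rootX negb_or => /andP[Ps s0].
by exists s.
Qed.

(** A nonzero weight gives a nontrivial character: X^n - 1 has a nonzero non-root, and negative
    weights follow by inversion. *)
Lemma exists_expz_neq1 (n : int) : n != 0 -> exists2 s : K, s != 0 & s ^ n != 1.
Proof.
have pos m : (0 < m)%N -> exists2 s : K, s != 0 & s ^+ m != 1.
  move=> m0; have [|s s0] := @exists_nonzero_nonroot ('X^m - 1).
    by rewrite -size_poly_eq0 size_XnsubC.
  by rewrite !hornerE subr_eq0; exists s.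
case: n => [[//|m] _|m _]; have [//|s s0 sm] := pos m.+1; exists s => //.
by rewrite NegzE -invr_expz invr_eq1.
Qed.

Section Subspace.
Variables (n : nat) (A : set (affine_space K n)).
Implicit Types F G : set (fsubspace A).

Let pt (x : fsubspace A) : 'rV[K]_n := val x.

Lemma zclosed_subaffine F :
  zclosed F <-> forall x, ~ F x -> exists p : {mpoly K[n]},
    p.@[pt x 0] != 0 /\ forall y, F y -> p.@[pt y 0] = 0.
Proof.
split=> [/zopen_subaffine cF x /cF[p [px sp]]|cF].
  exists p; split=> // y Fy; apply/eqP/negPn/negP => /sp; exact.
apply/zopen_subaffine => x /cF[p [px sp]]; exists p; split=> // y py Fy.
by move: py; rewrite -[val y]/(pt y) sp ?eqxx.
Qed.

Lemma zclosed_zeros (p : {mpoly K[n]}) :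
  zclosed [set x : fsubspace A | p.@[pt x 0] = 0].
Proof. by apply/zclosed_subaffine => x /eqP px; exists p. Qed.

Definition axis (k : 'I_n) : set (fsubspace A) :=
  [set x | exists s, pt x = s *: delta_mx 0 k].

Lemma axisP k x : axis k x <-> forall j, j != k -> pt x 0 j = 0.
Proof.
split=> [[s ->] j jk|xk]; first by rewrite !mxE (negbTE jk) andbF mulr0.
exists (pt x 0 k); apply/rowP => j; rewrite !mxE /=.
by have [->|/xk ->] := eqVneq j k; rewrite ?mulr1 ?mulr0.
Qed.

Lemma axis_coord k x : axis k x -> pt x = pt x 0 k *: delta_mx 0 k.
Proof. by move=> [s xE]; rewrite {2}xE !mxE !eqxx mulr1. Qed.

Lemma zclosed_axis k : zclosed (axis k).
Proof.
apply/zclosed_subaffine => x kx.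
have [j [jk xj]] : exists j, j != k /\ pt x 0 j != 0.
  apply: contrapT => nj; apply: kx; apply/axisP => j jk.
  by apply/eqP/negPn/negP => xj; apply: nj; exists j.
exists 'X_j; rewrite mevalXU; split=> // y /axisP ky.
by rewrite mevalXU ky.
Qed.

(** Polynomials separating points of the axis from [F] and from [G] restrict to nonzero univariate
    polynomials; a non-root of their product lies in neither set. *)
Lemma irreducible_axis k :
  (forall s, A (s *: delta_mx 0 k : 'rV[K]_n)) -> irreducible (axis k).
Proof.
move=> kA.
pose c s : fsubspace A := exist _ (s *: delta_mx 0 k) (mem_set (kA s)).
have cL s : axis k (c s) by exists s.
split; first by exists (c 0).
move=> F G /zclosed_subaffine cF /zclosed_subaffine cG kFG.
apply: contrapT => /not_orP[nF nG].
have [x [/axis_coord xE Fx]] : exists x, axis k x /\ ~ F x.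
  apply: contrapT => nx; apply: nF => x kx.
  by apply: contrapT => Fx; apply: nx; exists x.
have [y [/axis_coord yE Gy]] : exists x, axis k x /\ ~ G x.
  apply: contrapT => nx; apply: nG => y ky.
  by apply: contrapT => Gy; apply: nx; exists y.
have [p [px pF]] := cF _ Fx; have [q [qy qG]] := cG _ Gy.
have [P PE] := meval_line p 0 (delta_mx 0 k).
have [Q QE] := meval_line q 0 (delta_mx 0 k).
have : P * Q != 0.
  rewrite mulf_neq0 //; [move: px; rewrite xE|move: qy; rewrite yE];
    rewrite -[_ *: _]add0r ?PE ?QE; apply: contraNneq => ->; by rewrite horner0.
move=> /exists_nonzero_nonroot[s _]; rewrite hornerM -PE -QE add0r.
by case: (kFG _ (cL s)) => [/pF|/qG];
  rewrite /pt /= => ->; rewrite ?mul0r ?mulr0 eqxx.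
Qed.

Lemma zclosed_point (x : fsubspace A) : zclosed [set x].
Proof.
apply/zclosed_subaffine => y yx.
have [j xyj] : exists j, pt y 0 j != pt x 0 j.
  apply: contrapT => nj; apply: yx; apply: val_inj; apply/rowP => j.
  by apply/eqP/negPn/negP => xj; apply: nj; exists j.
exists ('X_j - (pt x 0 j)%:MP); rewrite mevalB mevalXU mevalC subr_eq0.
by split=> // _ ->; rewrite mevalB mevalXU mevalC subrr.
Qed.

Lemma axis_chain k : (forall s, A (s *: delta_mx 0 k : 'rV[K]_n)) ->
  exists Z, irreducible_chain (X := fsubspace A) 1 Z.
Proof.
move=> kA.
pose c s : fsubspace A := exist _ (s *: delta_mx 0 k) (mem_set (kA s)).
have cL s : axis k (c s) by exists s.
exists (fun i => if i is 0%N then [set c 0] else axis k); split.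
  case=> [_|i _]; last by split; [exact: zclosed_axis | exact: irreducible_axis].
  split; first exact: zclosed_point.
  split; first by exists (c 0).
  by move=> F G _ _ /(_ (c 0) erefl)[?|?]; [left|right] => _ ->.
case=> // _; split=> [_ ->|]; first by exists 0.
move=> /(_ (c 1) (cL 1)).
move=> /(congr1 (fun x => pt x 0 k)); rewrite /pt /= scale1r scale0r !mxE !eqxx.
by move/eqP; rewrite oner_eq0.
Qed.

(** A polynomial vanishing on [G] but not on [F] restricts to a nonzero [P] on the axis. Splitting
    off the full power of its root at a point of [G] covers [G] by that point and the zeros of the
    cofactor; irreducibility leaves the point alone, where the cofactor is nonzero. *)
Lemma proper_closed_in_axis k F G : zclosed G -> irreducible G ->
  G `<` F -> F `<=` axis k -> exists x, G = [set x].
Proof.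
move=> /zclosed_subaffine cG [[x Gx] irrG] [sGF nFG] Fk; exists x.
have [y [Fy Gy]] : exists y, F y /\ ~ G y.
  apply: contrapT => ny; apply: nFG => z Fz.
  by apply: contrapT => Gz; apply: ny; exists z.
have [p [py pG]] := cG _ Gy; have [P PE] := meval_line p 0 (delta_mx 0 k).
have kE z : F z -> pt z = 0 + pt z 0 k *: delta_mx 0 k.
  by rewrite add0r => /Fk/axis_coord.
have P0 : P != 0.
  by apply: contraNneq py => P0; rewrite (kE _ Fy) PE P0 horner0.
have [m [q]] := multiplicity_XsubC P (pt x 0 k); rewrite P0 /= => qx PqE.
(* The cofactor is read as a polynomial in the coordinate [k], so that its zeros form a closed
   subset. *)
have [q' q'E] : exists q' : {mpoly K[n]}, forall v, q'.@[v] = q.[v k].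
  exists (\sum_(i < size q) q`_i *: 'X_k ^+ i) => v.
  rewrite horner_coef raddf_sum; apply: eq_bigr => i _.
  by rewrite /= mevalZ rmorphXn /= mevalXU.
have [|xk|] := irrG [set z | ('X_k - (pt x 0 k)%:MP).@[pt z 0] = 0]
    [set z | q'.@[pt z 0] = 0] (zclosed_zeros _) (zclosed_zeros _).
- move=> z Gz; have := pG _ Gz; rewrite (kE _ (sGF _ Gz)) PE PqE.
  move/eqP; rewrite hornerM horner_exp !hornerE mulf_eq0 expf_eq0.
  case/orP => [/eqP qz|/andP[_ /eqP xz]]; [right|left]; first by rewrite /= q'E.
  by rewrite /= mevalB mevalXU mevalC.
- apply/seteqP; split=> [z Gz|_ -> //]; apply: val_inj => /=.
  have /eqP := xk _ Gz; rewrite mevalB mevalXU mevalC subr_eq0 => /eqP zx.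
  by rewrite -[val z]/(pt z) (kE _ (sGF _ Gz)) zx -(kE _ (sGF _ Gx)).
- by move=> /(_ _ Gx)/eqP; rewrite q'E -/(root q _) (negbTE qx).
Qed.

(** In a chain of length 2 the third member lies in one axis by irreducibility, so the second is a
    point and leaves no room for a nonempty first one. *)
Lemma chain_in_axes k l m Z : (forall x, axis k x \/ axis l x) ->
  irreducible_chain (X := fsubspace A) m Z -> (m <= 1)%N.
Proof.
move=> kl [irrZ ltZ]; case: m => [|[|m]] // in irrZ ltZ *; exfalso.
have [j Z2j] : exists j, Z 2%N `<=` axis j.
  have [_ [_ irr2]] := irrZ 2%N isT.
  have [||] := irr2 (axis k) (axis l) (zclosed_axis k) (zclosed_axis l).
  - by move=> x _; exact: kl.
  - by exists k.
  - by exists l.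
have [c1 irr1] := irrZ 1%N isT.
have [x Z1E] := proper_closed_in_axis c1 irr1 (ltZ 1%N isT) Z2j.
have [s01 n10] := ltZ 0%N isT; have [_ [[y Zy] _]] := irrZ 0%N isT.
by apply: n10; rewrite Z1E => _ ->; have := s01 _ Zy; rewrite Z1E => <-.
Qed.

End Subspace.
End Lines.

(** * The torus quotient *)

Section Torus.
Variable K : closedFieldType.

Definition row4 (x y z w : K) : 'rV[K]_4 := \row_j [:: x; y; z; w]`_j.

Lemma row4P (v w : 'rV[K]_4) : v 0 (o4 0) = w 0 (o4 0) ->
  v 0 (o4 1) = w 0 (o4 1) -> v 0 (o4 2) = w 0 (o4 2) ->
  v 0 (o4 3) = w 0 (o4 3) -> v = w.
Proof.
by move=> e0 e1 e2 e3; apply/rowP => j; case: (ord4_cases j) => [[]|[]] ->.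
Qed.

Lemma torus_actE t (v : 'rV[K]_4) : torus_act t v =
  row4 (t.1 * v 0 (o4 0)) (t.1 * v 0 (o4 1))
       (t.1 * t.2 * v 0 (o4 2)) (t.1 * t.2^-1 * v 0 (o4 3)).
Proof.
by apply: row4P; rewrite !mxE /= ?expr1z ?expr0z ?mulr1.
Qed.

(** If the stabilizer of [v] acts on the fibre through a nontrivial character, invariance multiplies
    G(v) by a scalar other than 1, so G(v) = 0. *)
Lemma unstable_fixed (b : linearization) (n : int) (v : 'rV[K]_4) : n != 0 ->
  (forall s : K, s != 0 -> exists t : K * K, [/\ torus t, torus_act t v = v &
     t.1 ^ b.1 * t.2 ^ b.2 = s ^ n]) ->
  unstable K b v.
Proof.
move=> n0 tv [d [G [d0 invG Gv]]].
have nd0 : n * Posz d != 0 by rewrite mulf_neq0 // -lt0n.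
have [s s0 snd] := @exists_expz_neq1 K _ nd0.
have [t [tT tvv tb]] := tv s s0.
move: snd => /negP; apply; apply/eqP/(mulIf Gv).
by rewrite mul1r -exprz_exp -tb -exprnP -invG // tvv.
Qed.

Lemma unstable_axis2 (b : linearization) (z : K) :
  b.1 != b.2 -> unstable K b (z *: delta_mx 0 (o4 2)).
Proof.
rewrite -subr_eq0 => b12; apply: (unstable_fixed b12) => s s0.
(* Z has weight t1 t2, trivial on this subgroup, which acts on the fibre with weight [b.1 - b.2]. *)
exists (s, s^-1); split; first by split=> //=; rewrite invr_eq0.
  by rewrite torus_actE; apply: row4P; rewrite !mxE /= ?mulr0 // divff // mul1r.
by rewrite exprz_inv expfzDr.
Qed.

Lemma unstable_axis3 (b : linearization) (z : K) :
  b.1 != - b.2 -> unstable K b (z *: delta_mx 0 (o4 3)).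
Proof.
rewrite -subr_eq0 opprK => b12; apply: (unstable_fixed b12) => s s0.
(* W has weight t1 / t2, trivial on the diagonal, which acts on the fibre with weight
   [b.1 + b.2]. *)
exists (s, s); split; first by split.
  by rewrite torus_actE; apply: row4P; rewrite !mxE /= ?mulr0 // divff // mul1r.
by rewrite expfzDr.
Qed.

Lemma unstable_axis (b : linearization) : b != (0, 0) ->
  exists k, forall s : K, unstable K b (s *: delta_mx 0 k).
Proof.
move=> b0; have [b12|b12] := eqVneq b.1 b.2; last first.
  by exists (o4 2) => s; exact: unstable_axis2.
exists (o4 3) => s; apply: unstable_axis3; apply: contraNneq b0.
case: b b12 => b1 b2 /= -> /eqP; rewrite -subr_eq0 opprK -mulr2n mulrn_eq0 /=.
by move=> /eqP ->.
Qed.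

Lemma semistable0 b (v : 'rV[K]_4) : b = (0, 0) -> semistable K b v.
Proof.
move=> ->; exists 1%N, 1; split=> //; last by rewrite meval1 oner_eq0.
by move=> t w _; rewrite !meval1 /= !expr0z !mulr1 expr1n.
Qed.

(** * Semistable points and efficiency of [alpha] *)

Definition alpha : linearization := (1, 0).

(** X and Y are invariant sections for d = 1 and ZW for d = 2. Where all three vanish, the point
    lies on one of the two unstable axes. *)
Lemma semistableP (v : 'rV[K]_4) : semistable K alpha v <->
  [\/ v 0 (o4 0) != 0, v 0 (o4 1) != 0 | v 0 (o4 2) * v 0 (o4 3) != 0].
Proof.
split=> [ssv|].
  have [v0|?] := eqVneq (v 0 (o4 0)) 0; last exact: Or31.
  have [v1|?] := eqVneq (v 0 (o4 1)) 0; last exact: Or32.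
  have [/eqP|?] := eqVneq (v 0 (o4 2) * v 0 (o4 3)) 0; last exact: Or33.
  rewrite mulf_eq0 => v23; exfalso; case/orP: v23 => /eqP vE.
    suff vE' : v = v 0 (o4 3) *: delta_mx 0 (o4 3).
      by move: ssv; rewrite vE'; exact: unstable_axis3.
    by apply: row4P; rewrite !mxE /= ?mulr0 ?mulr1.
  suff vE' : v = v 0 (o4 2) *: delta_mx 0 (o4 2).
    by move: ssv; rewrite vE'; exact: unstable_axis2.
  by apply: row4P; rewrite !mxE /= ?mulr0 ?mulr1.
case=> vE; [exists 1%N, 'X_(o4 0)|exists 1%N, 'X_(o4 1)|
  exists 2%N, ('X_(o4 2) * 'X_(o4 3))]; split=> //; rewrite ?mevalM ?mevalXU //;
  move=> t w [t1 t2]; rewrite torus_actE ?mevalM !mevalXU !mxE /= expr1z expr0z.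
- by rewrite mulr1 expr1.
- by rewrite mulr1 expr1.
- by rewrite /=; field.
Qed.

Lemma unstable_alpha (x : fsubspace (unstable K alpha)) :
  axis (o4 2) x \/ axis (o4 3) x.
Proof.
have ux : ~ semistable K alpha (val x) := set_valP x.
set v : 'rV[K]_4 := val x.
have [v0 v1 v23] : [/\ v 0 (o4 0) = 0, v 0 (o4 1) = 0 &
    v 0 (o4 2) * v 0 (o4 3) = 0].
  by split; apply/eqP/negPn/negP => h; apply: ux; apply/semistableP;
    [apply: Or31|apply: Or32|apply: Or33].
move/eqP: v23; rewrite mulf_eq0 => /orP[]/eqP vE;
  [right | left]; apply/axisP => j;
  by case: (ord4_cases j) => [[]|[]] -> // /eqP.
Qed.

Lemma Ed_alpha : Ed K alpha 1.
Proof.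
split; first by apply: (axis_chain (k := o4 2)) => s; exact: unstable_axis2.
by move=> m Z; apply: (chain_in_axes (k := o4 2) (l := o4 3)); exact: unstable_alpha.
Qed.

(** For the trivial linearization no point is unstable, so no chain exists; any other one
    destabilizes an axis, which carries a chain of length 1. *)
Lemma Ed_gt0 (b : linearization) m : Ed K b m -> (0 < m)%N.
Proof.
move=> [[Z [irrZ _]] maxm]; have [b0|b0] := eqVneq b (0, 0).
  have [_ [[x _] _]] := irrZ 0%N isT; case: (set_valP x).
  exact: semistable0.
have [k kb] := unstable_axis b0; have [Z' chainZ'] := axis_chain kb.
exact: maxm chainZ'.
Qed.

Lemma efficient_alpha : efficient K alpha.
Proof. by exists 1%N; [exact: Ed_alpha | exact: Ed_gt0]. Qed.

(** * The quotient map and its universal property *)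

Let ss := fsubspace (semistable K alpha).

Let pt (x : ss) : 'rV[K]_4 := val x.

Definition invariants (x : ss) : 'rV[K]_3 :=
  row3 (pt x 0 (o4 0)) (pt x 0 (o4 1)) (pt x 0 (o4 2) * pt x 0 (o4 3)).

Lemma invariants_neq0 x : invariants x != 0.
Proof.
apply/eqP => /rowP x0; have := x0 (o3 0); have := x0 (o3 1); have := x0 (o3 2).
rewrite !mxE /= => e2 e1 e0.
by have /semistableP := set_valP x; rewrite -/(pt x) e0 e1 e2 eqxx; case.
Qed.

Definition to_punctured (x : ss) : punctured K := mk_punctured (invariants_neq0 x).

Lemma regular_map_to_punctured : regular_map to_punctured.
Proof.
apply: (regular_map_subaffine (P := fun j =>
  [:: 'X_(o4 0); 'X_(o4 1); 'X_(o4 2) * 'X_(o4 3)]`_j)) => x j.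
by case: (ord3_cases j) => ->; rewrite mxE /= ?mevalM !mevalXU.
Qed.

Lemma semistable_row4 (x y z w : K) :
  row3 x y (z * w) != 0 -> semistable K alpha (row4 x y z w).
Proof.
by move=> /row3_neq0; rewrite !mxE /= => h; apply/semistableP; rewrite !mxE.
Qed.

Lemma semistable_section (u : punctured K) : semistable K alpha
  (row4 (vec u 0 (o3 0)) (vec u 0 (o3 1)) (vec u 0 (o3 2)) 1).
Proof.
apply: semistable_row4; rewrite mulr1.
suff -> : row3 (vec u 0 (o3 0)) (vec u 0 (o3 1)) (vec u 0 (o3 2)) = vec u.
  exact: vec_neq0.
by apply: row3P; rewrite mxE.
Qed.

(* The slice W = 1 is a global section of the invariants (X, Y, ZW). *)
Definition of_punctured (u : punctured K) : ss :=
  exist _ (row4 (vec u 0 (o3 0)) (vec u 0 (o3 1)) (vec u 0 (o3 2)) 1 :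
    affine_space K 4) (mem_set (semistable_section u)).

Lemma pt_of_punctured u : pt (of_punctured u) =
  row4 (vec u 0 (o3 0)) (vec u 0 (o3 1)) (vec u 0 (o3 2)) 1.
Proof. by []. Qed.

Lemma regular_map_of_punctured : regular_map of_punctured.
Proof.
apply: (regular_map_subaffine (P := fun j =>
  [:: 'X_(o3 0); 'X_(o3 1); 'X_(o3 2); 1]`_j)) => u j.
by case: (ord4_cases j) => [[]|[]] ->; rewrite mxE /= ?meval1 ?mevalXU.
Qed.

Lemma of_puncturedK u : to_punctured (of_punctured u) = u.
Proof.
by apply: val_inj; apply: row3P; rewrite /= /invariants !mxE /= ?mulr1.
Qed.

Lemma same_orbit_of_punctured u v :
  weighted_orbit u v -> same_orbit (of_punctured u) (of_punctured v).
Proof.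
(* The diagonal of the torus preserves W = 1 and acts on X, Y, Z with weights 1, 1, 2. *)
move=> /weighted_orbitP[l l0 [e0 e1 e2]]; exists (l, l); first by split.
rewrite -[val _]/(pt _) -[val (of_punctured u)]/(pt _).
rewrite !pt_of_punctured torus_actE.
by apply: row4P; rewrite !mxE /= ?e0 ?e1 ?e2 // ?divff ?mulr1 // expr2.
Qed.

Lemma to_punctured_invariant x y :
  same_orbit x y -> weighted_orbit (to_punctured x) (to_punctured y).
Proof.
move=> [t [t1 t2] yE]; apply/weighted_orbitP; exists t.1 => //.
rewrite !vec_mk !mxE /= /pt yE torus_actE !mxE /=; split=> //.
by field.
Qed.

Section Invariant.
Variables (Y : fspace K) (f : ss -> Y).
Hypotheses (vY : variety Y) (rf : regular_map f)
  (invf : forall x y, same_orbit x y -> f x = f y).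

(* If ZW = 0, then the closure of the orbit contains (X, Y, 0, 0). *)
Lemma invariant_degeneration (x x0 : ss) : pt x 0 (o4 2) * pt x 0 (o4 3) = 0 ->
  pt x0 = row4 (pt x 0 (o4 0)) (pt x 0 (o4 1)) 0 0 -> f x = f x0.
Proof.
move=> x23 x0E.
(* The line from [x0] in this direction stays in the orbit of [x] away from s = 0, since at most one
   entry of [w] is nonzero. *)
pose w := row4 0 0 (pt x 0 (o4 2)) (pt x 0 (o4 3)).
have ssc s : semistable K alpha (pt x0 + s *: w).
  have /semistableP := set_valP x0; rewrite -/(pt x0) => x0P.
  apply/semistableP; move: x0P; rewrite x0E !mxE /= !mulr0 !addr0 eqxx.
  by case=> // ?; [apply: Or31|apply: Or32].
pose c s : ss := exist _ (pt x0 + s *: w : affine_space K 4) (mem_set (ssc s)).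
have cx s : s != 0 -> f (c s) = f x.
  move=> s0; apply/esym/invf; move/eqP: x23; rewrite mulf_eq0 => /orP[]/eqP xE.
    exists (1, s^-1); first by split; rewrite ?oner_eq0 ?invr_eq0.
    rewrite torus_actE /= x0E; apply: row4P;
      by rewrite !mxE /= -?[val x]/(pt x) ?xE ?invrK; ring.
  exists (1, s); first by split; rewrite ?oner_eq0.
  rewrite torus_actE /= x0E; apply: row4P;
    by rewrite !mxE /= -?[val x]/(pt x) ?xE; ring.
apply: contrapT => fx.
(* If the values differed, the open set where [f] avoids [f x] would contain [x0] and hence some
   point of the line with s nonzero. *)
have [of_ _] := rf; have /of_/zopen_subaffine := closed_point (f x) vY.
move=> /(_ x0) [fx0|p [px0 sp]]; first exact/fx/esym.
have [P PE] := meval_line p (pt x0) w.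
have : P != 0.
  apply: contraNneq px0 => P0; have := PE 0; rewrite scale0r addr0 P0 horner0.
  by move=> <-.
move=> /exists_nonzero_nonroot[s s0]; rewrite -PE => ps.
exact: (sp (c s) ps (cx s s0)).
Qed.

(** If W is nonzero, the torus element (1, W) moves the point to the slice. Otherwise both points
    degenerate to (X, Y, 0, 0). *)
Lemma invariant_factor x : f x = f (of_punctured (to_punctured x)).
Proof.
have [x3|x3] := eqVneq (pt x 0 (o4 3)) 0; last first.
  apply: invf; exists (1, pt x 0 (o4 3)); first by split; rewrite ?oner_eq0.
  rewrite -[val _]/(pt _) pt_of_punctured torus_actE vec_mk /invariants.
  apply: row4P; rewrite !mxE /= !mul1r // -?[val x]/(pt x) ?mulVf //.
  exact: mulrC.
have ss0 : semistable K alpha (row4 (pt x 0 (o4 0)) (pt x 0 (o4 1)) 0 0).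
  apply: semistable_row4; have := invariants_neq0 x.
  by rewrite /invariants x3 !mulr0.
pose x0 : ss := exist _ (row4 (pt x 0 (o4 0)) (pt x 0 (o4 1)) 0 0 :
  affine_space K 4) (mem_set ss0).
rewrite (@invariant_degeneration x x0) ?x3 ?mulr0 //.
apply/esym/invariant_degeneration; rewrite pt_of_punctured vec_mk !mxE /=.
  by rewrite x3 !(mulr0, mul0r).
by [].
Qed.

End Invariant.

Lemma git_quotient_CP112 : 2%:R != 0 :> K ->
  git_quotient (fun x : ss => cls (to_punctured x)).
Proof.
move=> K2; split.
- exact: variety_CP112.
- exact: (regular_map_comp regular_map_to_punctured (@regular_map_cls K)).
- by move=> x y /to_punctured_invariant/clsE.
move=> Y f vY rf invf; pose h O := f (of_punctured (rep O)).
have hE u : h (cls u) = f (of_punctured u).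
  by apply/esym/invf/same_orbit_of_punctured; exact: rep_cls.
exists h; split; last first.
  move=> h' [_ h'E]; apply: funext => O.
  by rewrite -[O]repK hE -h'E of_puncturedK.
split; last by move=> x; rewrite hE -invariant_factor.
have [oc rc] := regular_map_comp regular_map_of_punctured rf.
(* Open sets and functions of [CP112] are tested after composition with [cls], so [h] inherits
   regularity from [f] on the slice. *)
have cE : f \o of_punctured = h \o @cls K by apply: funext => u; rewrite /= hE.
rewrite cE in oc rc; split=> [U oU|U k oU rk].
  by apply/zopen_CP112; exact: oc.
by apply/regular_CP112; exact: (rc U k oU rk).
Qed.

Lemma isomorphic_refl (X : fspace K) : isomorphic X X.
Proof. by exists id, id; split. Qed.

End Torus.

Theorem theoremA (R : realType) (B : {mpoly R[i][4]}) (hB : honda_quartic B) :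
  exists alpha : linearization,
    efficient R[i] alpha /\
    exists (Q : fspace R[i]) (p : fsubspace (semistable R[i] alpha) -> Q),
      git_quotient p /\ isomorphic Q (CP112 R[i]).
Proof.
exists alpha; split; first exact: efficient_alpha.
exists (CP112 R[i]), (fun x => cls (to_punctured x)); split.
  by apply: git_quotient_CP112; rewrite pnatr_eq0.
exact: isomorphic_refl.
Qed.
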